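(* Let $r\in\{1,2,3,\dots\}\cup\{\infty\}$ and let $\mathbb{F}_r$ be the free group of rank $r$ (countably infinite rank if $r=\infty$). Let $\alpha: \mathbb{F}_r\curvearrowright X$ be a minimal topologically free action on the Cantor set $X$ such that there exists an $\mathbb{F}_r$-invariant Borel probability measure on $X$. Then the topological full group $[[\alpha]]$ is LEF. In particular, there exists a minimal free $\mathbb{F}_r$-Toeplitz subshift $\beta$ whose topological full group $[[\beta]]$ is LEF and thus sofic.
   Context: The topological full group $[[\alpha]]$ of $\alpha:G\curvearrowright X$ ($G$ countable discrete, $X$ the Cantor set) is the group of all homeomorphisms $\varphi: X\to X$ for which there is a continuous map $c: X\to G$ ($G$ discrete) with $\varphi(x)=\alpha_{c(x)}(x)$ for all $x\in X$. An action is topologically free if for each $g\neq e$ the fixed-point set of $g$ has empty interior; free if all stabilizers are trivial. For a countable group $G$ and a finite alphabet $\Sigma$, $G$ acts on $\Sigma^G$ by $(g\cdot x)(h)=x(g^{-1}h)$. An element $x\in\Sigma^G$ is Toeplitz if for every $h\in G$ there is a finite-index subgroup $H\le G$ with $x(\gamma h)=x(h)$ for all $\gamma\in H$. A $G$-Toeplitz subshift is the restriction of the shift action to the orbit closure of a Toeplitz element. A group $G$ is LEF if for any finite $H\subset G$ there is a finite set $K$ with $H\subset K\subset G$ and a binary operation $\odot: K^2\to K$ making $(K,\odot)$ a group such that $h_1\cdot h_2=h_1\odot h_2$ for all $h_1,h_2\in H$. A countable group $\Gamma$ is sofic if for any finite $F\subset\Gamma$ and $\epsilon>0$ there are a finite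 nonempty set $A$ and a map $\Theta:\Gamma\to \operatorname{Map}(A)$ (all maps $A\to A$) such that $\Theta(e)=\mathrm{id}_A$; $d_H(\Theta(fg),\Theta(f)\Theta(g))\le\epsilon$ whenever $f,g,fg\in F$; and $d_H(\Theta(f),\mathrm{id}_A)>1-\epsilon$ for $e\neq f\in F$, where $d_H(f,g)=|\{x\in A: f(x)\neq g(x)\}|/|A|$. *)

(* Defs.v *)
From HB Require Import structures.
From mathcomp Require Import all_boot all_order all_algebra.
From mathcomp Require Import finmap.
From mathcomp Require Import all_classical all_reals all_analysis.

Set Implicit Arguments.
Unset Strict Implicit.
Unset Printing Implicit Defensive.

Import Order.TTheory GRing.Theory Num.Theory.

Local Open Scope classical_set_scope.
Local Open Scope group_scope.

Section FreeGroup.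
Variable A : choiceType.

(* The letter [(a, false)] is the generator [a], and [(a, true)] its formal
   inverse. *)
Definition letter : Type := (A * bool)%type.
Definition linv (l : letter) : letter := (l.1, ~~ l.2).

Definition reduced (w : seq letter) : bool :=
  sorted (fun l m => m != linv l) w.

Definition cons_red (l : letter) (w : seq letter) : seq letter :=
  if w is m :: w' then if m == linv l then w' else l :: w else [:: l].

Definition reduce (w : seq letter) : seq letter := foldr cons_red [::] w.

Definition winv (w : seq letter) : seq letter := rev (map linv w).

Lemma linvK : involutive linv.
Proof. by case=> a b; rewrite /linv /= negbK. Qed.

Lemma linv_eq (l m : letter) : (m == linv l) = (l == linv m).
Proof. by apply/eqP/eqP => ->; rewrite linvK. Qed.

Lemma reduced_behead l w : reduced (l :: w) -> reduced w.
Proof. by case: w => //= m w /andP[]. Qed.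

Lemma cons_red_reduced l w : reduced w -> reduced (cons_red l w).
Proof.
case: w => //= m w rw; case: ifPn => [_|mNl]; last by rewrite /= mNl.
exact: (@reduced_behead m).
Qed.

Lemma reduce_reduced w : reduced (reduce w).
Proof. by elim: w => //= l w; exact: cons_red_reduced. Qed.

Lemma foldr_cons_red_reduced u w : reduced w -> reduced (foldr cons_red w u).
Proof. by move=> rw; elim: u => //= l u; exact: cons_red_reduced. Qed.

Lemma cons_redE l w : reduced (l :: w) -> cons_red l w = l :: w.
Proof. by case: w => //= m w /andP[/negPf ->]. Qed.

Lemma reduce_id w : reduced w -> reduce w = w.
Proof.
elim: w => //= l w IH rlw; have rw := reduced_behead rlw.
by rewrite IH// cons_redE.
Qed.

Lemma cons_redK l w : reduced w -> cons_red l (cons_red (linv l) w) = w.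
Proof.
case: w => [|m w] rw; first by rewrite /= eqxx.
rewrite [cons_red (linv l) _]/= linvK; case: ifPn => [/eqP <-|_].
  exact: cons_redE.
by rewrite /= eqxx.
Qed.

Lemma foldr_cons_red l u w : reduced w ->
  foldr cons_red w (cons_red l u) = cons_red l (foldr cons_red w u).
Proof.
case: u => //= m u rw; case: ifP => // /eqP ->.
by rewrite cons_redK// foldr_cons_red_reduced.
Qed.

Lemma foldr_reduce u w : reduced w ->
  foldr cons_red w (reduce u) = foldr cons_red w u.
Proof. by move=> rw; elim: u => //= l u IH; rewrite foldr_cons_red// IH. Qed.

Lemma reduce_cat u v : reduce (u ++ v) = foldr cons_red (reduce v) u.
Proof. by rewrite /reduce foldr_cat. Qed.

Lemma reduce_catl u v : reduce (reduce u ++ v) = reduce (u ++ v).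
Proof. by rewrite !reduce_cat foldr_reduce// reduce_reduced. Qed.

Lemma reduce_catr u v : reduce (u ++ reduce v) = reduce (u ++ v).
Proof. by rewrite !reduce_cat reduce_id// reduce_reduced. Qed.

Lemma reduce_winvl w : reduce (winv w ++ w) = [::].
Proof.
rewrite /winv; elim: w => //= l w IH.
rewrite rev_cons cat_rcons reduce_cat /= -{2}[l]linvK cons_redK.
  by rewrite -reduce_cat IH.
exact: reduce_reduced.
Qed.

Lemma winvK : involutive winv.
Proof.
by move=> w; rewrite /winv map_rev revK -map_comp map_id_in// => l _ /=;
  rewrite linvK.
Qed.

Lemma reduce_winvr w : reduce (w ++ winv w) = [::].
Proof. by rewrite -{1}[w]winvK reduce_winvl. Qed.

Definition free_group : Type := {w : seq letter | reduced w}.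
HB.instance Definition _ := SubChoice.on free_group.

Definition fg_mk (w : seq letter) : free_group :=
  exist _ (reduce w) (reduce_reduced w).
Definition fg_mul (u v : free_group) : free_group := fg_mk (val u ++ val v).
Definition fg_one : free_group := fg_mk [::].
Definition fg_inv (u : free_group) : free_group := fg_mk (winv (val u)).

Lemma fg_mulA : associative fg_mul.
Proof.
by move=> u v w; apply: val_inj; rewrite /= reduce_catl reduce_catr catA.
Qed.

Lemma fg_mul1g : left_id fg_one fg_mul.
Proof. by move=> u; apply: val_inj; rewrite /= reduce_id// (valP u). Qed.

Lemma fg_mulg1 : right_id fg_one fg_mul.
Proof. by move=> u; apply: val_inj; rewrite /= cats0 reduce_id// (valP u). Qed.

Lemma fg_mulVg : left_inverse fg_one fg_inv fg_mul.
Proof. by move=> u; apply: val_inj; rewrite /= reduce_catl reduce_winvl. Qed.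

Lemma fg_mulgV : right_inverse fg_one fg_inv fg_mul.
Proof. by move=> u; apply: val_inj; rewrite /= reduce_catr reduce_winvr. Qed.

HB.instance Definition _ :=
  isGroup.Build free_group fg_mulA fg_mul1g fg_mulg1 fg_mulVg fg_mulgV.

End FreeGroup.

(* Ranks are elements of [option nat], with [None] standing for a countably
   infinite rank. *)
Definition generators (r : option nat) : choiceType :=
  if r is Some n then 'I_n else nat.

Definition free_group_of_rank (r : option nat) : groupType :=
  free_group (generators r).

Definition inverse_homeomorphisms (X Y : topologicalType)
    (f : X -> Y) (g : Y -> X) : Prop :=
  [/\ continuous f, continuous g, cancel f g & cancel g f].

Definition homeomorphic (X Y : topologicalType) : Prop :=
  exists (f : X -> Y) (g : Y -> X), inverse_homeomorphisms f g.

Record homeo (X : topologicalType) := Homeo {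
  homeo_fun :> X -> X;
  homeo_inv : X -> X;
  homeoP : inverse_homeomorphisms homeo_fun homeo_inv }.

Section HomeoGroup.
Variable X : topologicalType.
Implicit Types f g h : homeo X.

Lemma homeo_ext f g : f =1 g -> f = g.
Proof.
case: f g => [f f' fP] [g g' gP] /= /funext fg; subst g.
have fg' : f' = g'.
  case: fP gP => _ _ _ f'K [_ _ gK _].
  by apply/funext => x; rewrite -{2}[x]f'K gK.
by subst g'; congr Homeo; exact: Prop_irrelevance.
Qed.

Lemma homeo_one_subproof : inverse_homeomorphisms (@id X) (@id X).
Proof. by split=> // x; exact: cvg_id. Qed.

Lemma homeo_mul_subproof f g :
  inverse_homeomorphisms (f \o g) (homeo_inv g \o homeo_inv f).
Proof.
case: (homeoP f) (homeoP g) => fc fc' fK fK' [gc gc' gK gK']; split.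
- by move=> x; apply: continuous_comp; [exact: gc|exact: fc].
- by move=> x; apply: continuous_comp; [exact: fc'|exact: gc'].
- by move=> x /=; rewrite fK gK.
- by move=> x /=; rewrite gK' fK'.
Qed.

Lemma homeo_inv_subproof f : inverse_homeomorphisms (homeo_inv f) f.
Proof. by case: (homeoP f). Qed.

Definition homeo_one : homeo X := Homeo homeo_one_subproof.
Definition homeo_mul f g : homeo X := Homeo (homeo_mul_subproof f g).
Definition homeo_invg f : homeo X := Homeo (homeo_inv_subproof f).

Lemma homeo_mulA : associative homeo_mul.
Proof. by move=> f g h; exact: homeo_ext. Qed.
Lemma homeo_mul1g : left_id homeo_one homeo_mul.
Proof. by move=> f; exact: homeo_ext. Qed.
Lemma homeo_mulg1 : right_id homeo_one homeo_mul.
Proof. by move=> f; exact: homeo_ext. Qed.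
Lemma homeo_mulVg : left_inverse homeo_one homeo_invg homeo_mul.
Proof. by move=> f; apply: homeo_ext => x /=; case: (homeoP f) => _ _ ->. Qed.
Lemma homeo_mulgV : right_inverse homeo_one homeo_invg homeo_mul.
Proof. by move=> f; apply: homeo_ext => x /=; case: (homeoP f) => _ _ _ ->. Qed.

HB.instance Definition _ := gen_eqMixin (homeo X).
HB.instance Definition _ := gen_choiceMixin (homeo X).
HB.instance Definition _ := isGroup.Build (homeo X)
  homeo_mulA homeo_mul1g homeo_mulg1 homeo_mulVg homeo_mulgV.

End HomeoGroup.

(* The product of [homeo X] is [f * g = f \o g], so a group morphism
   [G -> homeo X] is a left action of the discrete group [G] on [X]. *)
Notation action G X := (UMagmaMorphism.type G (homeo X)).

Section Actions.
Variables (G : groupType) (X : topologicalType) (alpha : action G X).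

Definition orbit (x : X) : set X := range (fun g : G => alpha g x).

Definition minimal : Prop := forall x : X, dense (orbit x).

Definition topologically_free : Prop :=
  forall g : G, g <> 1 -> interior [set x | alpha g x = x] = set0.

Definition free_action : Prop :=
  forall (g : G) (x : X), alpha g x = x -> g = 1.

Definition in_full_group : pred (homeo X) := fun f =>
  `[< exists2 c : X -> discrete_topology G,
        continuous c & forall x, f x = alpha (c x : G) x >].

Lemma continuous_discreteP (Y : topologicalType) (c : Y -> discrete_topology G) :
  continuous c <-> forall x, \forall y \near x, c y = c x.
Proof.
split=> cc x.
  by have /discrete_cvg := cc x.
apply/discrete_cvg; exact: cc.
Qed.

Lemma full_group_closed : group_closed in_full_group.
Proof.
split.
  apply/asboolP; exists (fun=> 1 : discrete_topology G); first exact: cst_continuous.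
  by move=> x; rewrite gmulf1.
move=> f g /asboolP[c /continuous_discreteP cc fc].
move=> /asboolP[d /continuous_discreteP dc gd]; apply/asboolP.
have [_ gVc gK gVK] := homeoP g.
exists (fun x => (c (homeo_inv g x) : G) / (d (homeo_inv g x) : G)
  : discrete_topology G).
  apply/continuous_discreteP => x.
  have c1 : \forall y \near x, c (homeo_inv g y) = c (homeo_inv g x).
    exact: gVc x _ (cc _).
  have d1 : \forall y \near x, d (homeo_inv g y) = d (homeo_inv g x).
    exact: gVc x _ (dc _).
  by apply: filterS2 c1 d1 => y -> ->.
move=> x; rewrite gmulfM gmulfV /= fc; congr (alpha _ _).
have [_ _ dK _] := homeoP (alpha (d (homeo_inv g x) : G)).
by rewrite -[LHS]dK -gd gVK.
Qed.

Definition topological_full_group : Type := {f : homeo X | in_full_group f}.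
HB.instance Definition _ := SubChoice.on topological_full_group.
HB.instance Definition _ := SubChoice_isSubGroup.Build
  (homeo X) in_full_group topological_full_group full_group_closed.

Variable x0 : X.

Definition orbit_closure : set X := closure (orbit x0).

Lemma orbit_closure_stable (g : G) (y : X) :
  orbit_closure y -> orbit_closure (alpha g y).
Proof.
move=> cy U Ug; have [gc _ _ _] := homeoP (alpha g).
have [_ [[h _ <-] Uh]] := cy _ (gc y _ Ug).
exists (alpha (g * h) x0); split; first by exists (g * h).
by rewrite gmulfM.
Qed.

(* A set used as a type carries the subspace topology. *)
Definition orbit_closure_map (g : G) (y : orbit_closure) : orbit_closure :=
  SigSub (mem_set (@orbit_closure_stable g _ (set_mem (valP y)))).

Lemma orbit_closure_map_continuous g : continuous (orbit_closure_map g).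
Proof.
apply: continuous_comp_initial => y.
have [gc _ _ _] := homeoP (alpha g).
apply: (@continuous_comp orbit_closure X X (@set_val X orbit_closure) (alpha g)).
  exact: (@initial_continuous orbit_closure X (@set_val X orbit_closure)).
exact: gc.
Qed.

Lemma orbit_closure_homeo_subproof g :
  inverse_homeomorphisms (orbit_closure_map g) (orbit_closure_map g^-1).
Proof.
split; [exact: orbit_closure_map_continuous..| |] => y; apply: val_inj => /=.
- by rewrite gmulfV /=; case: (homeoP (alpha g)) => _ _ ->.
- by rewrite gmulfV /=; case: (homeoP (alpha g)) => _ _ _ ->.
Qed.

Definition orbit_closure_action (g : G) : homeo orbit_closure :=
  Homeo (orbit_closure_homeo_subproof g).

Lemma orbit_closure_actionM :
  {morph orbit_closure_action : g h / g * h >-> g * h}.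
Proof.
by move=> g h; apply: homeo_ext => y; apply: val_inj => /=; rewrite gmulfM.
Qed.

Lemma orbit_closure_action1 : orbit_closure_action 1 = 1.
Proof.
by apply: homeo_ext => y; apply: val_inj => /=; rewrite gmulf1.
Qed.

HB.instance Definition _ := isUMagmaMorphism.Build
  G (homeo orbit_closure) orbit_closure_action
  (orbit_closure_action1, orbit_closure_actionM).

End Actions.

Definition borel (X : ptopologicalType) := g_sigma_algebraType (@open X).

Definition invariant_probability (R : realType) (G : groupType)
    (X : ptopologicalType) (alpha : action G X)
    (mu : probability (borel X) R) : Prop :=
  forall (g : G) (B : set (borel X)),
    measurable B -> mu (alpha g @^-1` B) = mu B.

Lemma continuous_to_prod (Y : topologicalType) (I : eqType)
    (K : I -> topologicalType) (f : Y -> prod_topology K) :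
  (forall i, continuous (fun y => f y i)) -> continuous f.
Proof.
move=> fc y; apply/cvg_sup => i U [_ [[V oV <-] Vx] VU].
have nV : nbhs y [set z | V (f z i)].
  by apply: (fc i y); exact: open_nbhs_nbhs.
by apply: filterS nV => z Vz; exact: VU.
Qed.

Section Shift.
Variables (G : groupType) (S : finType).

Definition full_shift : Type := prod_topology (fun _ : G => discrete_topology S).
HB.instance Definition _ := Topological.on full_shift.

Definition shift_map (g : G) (x : full_shift) : full_shift :=
  fun h => x (g^-1 * h).

Lemma shift_map_continuous g : continuous (shift_map g).
Proof.
apply: (@continuous_to_prod full_shift G (fun=> discrete_topology S)) => h.
exact: (@proj_continuous G (fun=> discrete_topology S) (g^-1 * h)).
Qed.

Lemma shift_homeo_subproof g :
  inverse_homeomorphisms (shift_map g) (shift_map g^-1).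
Proof.
split; [exact: shift_map_continuous..| |] => x; apply/funext => h.
- by rewrite /shift_map invgK mulKg.
- by rewrite /shift_map invgK mulVKg.
Qed.

Definition shift (g : G) : homeo full_shift := Homeo (shift_homeo_subproof g).

Lemma shiftM : {morph shift : g h / g * h >-> g * h}.
Proof.
move=> g h; apply: homeo_ext => x; apply/funext => k /=.
by rewrite /shift_map invgM mulgA.
Qed.

Lemma shift1 : shift 1 = 1.
Proof.
by apply: homeo_ext => x; apply/funext => k /=; rewrite /shift_map invg1 mul1g.
Qed.

HB.instance Definition _ := isUMagmaMorphism.Build
  G (homeo full_shift) shift (shift1, shiftM).

Definition finite_index (H : groupClosed G) : Prop :=
  finite_set (range (fun g : G => [set k : G | g^-1 * k \in H])).

Definition toeplitz (x : full_shift) : Prop :=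
  forall h : G, exists2 H : groupClosed G,
    finite_index H & forall k : G, k \in H -> x (k * h) = x h.

Definition subshift (x : full_shift) : action G (orbit_closure shift x) :=
  orbit_closure_action shift x.

End Shift.

Definition is_group_law (T : Type) (op : T -> T -> T) : Prop :=
  associative op /\
  exists (e : T) (inv : T -> T),
    [/\ left_id e op, right_id e op, left_inverse e inv op
      & right_inverse e inv op].

Definition LEF (G : groupType) : Prop :=
  forall H : {fset G}, exists (K : {fset G}) (op : K -> K -> K),
    [/\ (H `<=` K)%fset, is_group_law op &
      forall h1 h2 : K, val h1 \in H -> val h2 \in H ->
        val (op h1 h2) = val h1 * val h2].

Definition hamming (R : realType) (A : finType) (f g : A -> A) : R :=
  (#|[set x : A | f x != g x]%SET|%:R / #|A|%:R)%R.

(* Soficity is a notion for countable groups, so countability is part of it. *)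
Definition sofic (R : realType) (G : groupType) : Prop :=
  countable [set: G] /\
  forall (F : {fset G}) (eps : R), (0 < eps)%R ->
    exists (A : finType) (Theta : G -> A -> A),
      [/\ (0 < #|A|)%N,
          Theta 1 = id,
          forall f g : G, f \in F -> g \in F -> f * g \in F ->
            (hamming R (Theta (f * g)%g) (Theta f \o Theta g) <= eps)%R
        & forall f : G, f \in F -> f <> 1 ->
            (1 - eps < hamming R (Theta f) id)%R].

(* Main.v *)
Require Import Defs.
From HB Require Import structures.
From mathcomp Require Import all_boot all_order perm all_algebra.
From mathcomp Require Import finmap.
From mathcomp Require Import all_classical all_reals all_analysis.
From mathcomp Require Import lra.

(** The argument goes through finite models of an action of [G] on [X]
    ([finitely_modelled]): finite [G]-sets whose elements are assigned points
    of [X] so that, at a prescribed finite resolution, finitely many elements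
    of [G] move the points as they move the elements of the set. An element of
    the topological full group is a locally constant choice of elements of [G],
    so it also acts on a model of sufficient resolution. When the action is
    topologically free this choice is unique, hence compatible with products,
    and finite parts of the full group embed into finite permutation groups
    ([LEF_full_group]).

    For a free group, models come from an invariant measure. Cut [X] into
    finitely many clopen atoms. Invariance says that the measures of the atoms
    solve a linear system with integer coefficients, stating that each
    generator preserves the distribution of the labels; minimality makes the
    solution positive, so the system has a solution in positive integers
    ([balanced_sample]). Read as multiplicities, these integers give a finite
    sample of points in which the points and their images under a generator
    show the same labels equally often, and matching them is a permutation of
    the sample ([sample_with_permutations]). Freeness of the group lets these
    permutations act together, and if labels are patterns over all prefixes of
    the given words, the permutations follow these words correctly
    ([finitely_modelled_free_group]).

    For the Toeplitz subshift, free groups being residually finite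
    ([free_group_residually_finite]), there is a strictly decreasing chain of
    finite-index normal subgroups [H_n] with trivial intersection, together
    with cosets [H_n t_n] decreasing to the empty set. The point whose symbol
    at [g] is the parity of the first [n] with [g] outside [H_n t_n] is
    Toeplitz, and has a free orbit closure because the alternation of symbols
    betrays each [H_n] ([toeplitz_free]). It has finite models without any
    recourse to measures: filling [H_n t_n] with a constant gives a periodic
    point with the same patterns as the Toeplitz point on any given window, if
    [n] is large ([toeplitz_finitely_modelled]). So its topological full group
    is LEF, and being countable it is sofic ([LEF_sofic]). *)

Set Implicit Arguments.
Unset Strict Implicit.
Unset Printing Implicit Defensive.

Import Order.TTheory GRing.Theory Num.Theory.

(** * Locally constant functions on compact spaces *)

Section LocallyConstant.
Local Open Scope classical_set_scope.
Implicit Type X : topologicalType.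

Definition locally_constant X (L : Type) (f : X -> L) : Prop :=
  forall x, \forall y \near x, f y = f x.

Lemma locally_constant_comp X (L M : Type) (h : L -> M) (f : X -> L) :
  locally_constant f -> locally_constant (h \o f).
Proof. by move=> fc x; apply: filterS (fc x) => y /= ->. Qed.

Lemma locally_constant_precomp X (Y : topologicalType) (L : Type)
    (f : Y -> L) (g : X -> Y) :
  continuous g -> locally_constant f -> locally_constant (f \o g).
Proof. by move=> gc fc x; exact: (gc x _ (fc (g x))). Qed.

Lemma locally_constant_pair X (L M : Type) (f : X -> L) (g : X -> M) :
  locally_constant f -> locally_constant g ->
  locally_constant (fun x => (f x, g x)).
Proof. by move=> fc gc x; apply: filterS2 (fc x) (gc x) => y -> ->. Qed.

Lemma locally_constant_map X (I : Type) (L : Type) (s : seq I)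
    (f : I -> X -> L) :
  (forall i, locally_constant (f i)) ->
  locally_constant (fun x => [seq f i x | i <- s]).
Proof.
move=> fc x; elim: s => [|i s IH] /=; first exact: nearW.
by apply: filterS2 (fc i x) IH => y -> ->.
Qed.

Lemma clopen_locally_constant X (U : set X) :
  clopen U -> locally_constant (fun x => `[< U x >]).
Proof.
move=> [oU cU] x; have [Ux|NUx] := pselect (U x).
  have : nbhs x U by exact: open_nbhs_nbhs.
  by apply: filterS => y Uy; apply/asboolP/asboolP.
have : nbhs x (~` U) by apply: open_nbhs_nbhs; split => //; exact: closed_openC.
by apply: filterS => y NUy; apply/asboolP/asboolP.
Qed.

Lemma locally_constant_open_preimage X (L : Type) (f : X -> L) (A : set L) :
  locally_constant f -> open (f @^-1` A).
Proof.
by move=> fc; rewrite openE => x Ax; apply: filterS (fc x) => y /= ->.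
Qed.

(** Compactness is used in this form: a property that holds locally with some
    witness holds everywhere with witnesses from a finite list. It is proved
    by letting the list of witnesses grow along the filter of its supersets.
    *)
Lemma compact_finite_witnesses X (T : eqType) (P : T -> X -> Prop) :
  compact [set: X] -> (forall x : X, exists t, \forall y \near x, P t y) ->
  exists s : seq T, forall y, exists2 t, t \in s & P t y.
Proof.
move=> /compact_near_coveringP cX PX.
pose F : set_system (seq T) :=
  fun U => exists s0 : seq T, forall s, {subset s0 <= s} -> U s.
have FF : Filter F.
  split; first by exists [::].
    move=> A B [s sA] [t tB]; exists (s ++ t) => u stu; split.
      by apply: sA => i si; apply: stu; rewrite mem_cat si.
    by apply: tB => i ti; apply: stu; rewrite mem_cat ti orbT.
  by move=> A B AB [s sA]; exists s => t /sA /AB.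
have := cX _ F (fun s y => exists2 t, t \in s & P t y) FF.
case=> [x _|s0 s0P]; last by exists s0 => y; exact: (s0P s0).
have [t Pt] := PX x.
exists ([set y | P t y], [set s | t \in s]) => /=.
  by split=> //; exists [:: t] => s; apply; rewrite inE.
by case=> y s /= [Pty ts]; exists t.
Qed.

Lemma locally_constant_finite_range X (L : Type) (f : X -> L) :
  compact [set: X] -> locally_constant f ->
  exists s : seq X, forall x, exists2 p, p \in s & f x = f p.
Proof. by move=> cX fc; apply: compact_finite_witnesses => // x; exists x. Qed.

End LocallyConstant.

(** * From partial actions on finite sets to LEF *)

Section LocalEmbeddings.
Local Open Scope classical_set_scope.
Local Open Scope group_scope.

Lemma LEF_finite_group (G : groupType) : finite_set [set: G] -> LEF G.
Proof.
move=> fG H.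
have inK (g : G) : g \in fset_set [set: G] by rewrite in_fset_set// inE.
pose op (h k : fset_set [set: G]) : fset_set [set: G] :=
  [` inK (val h * val k)]%fset.
exists (fset_set [set: G]), op; split => //.
  by apply/fsubsetP => g _; exact: inK.
split; first by move=> f g h; apply: val_inj; rewrite /= mulgA.
exists [` inK 1]%fset, (fun h => [` inK (val h)^-1]%fset).
by split=> h; apply: val_inj; rewrite /= ?mul1g ?mulg1 ?mulVg ?mulgV.
Qed.

(** The definition of LEF wants the finite group to be carried by a subset of
    [G] itself; in an infinite group there is always room to copy a finite
    group [Gam] onto a set [K], whatever the part of it prescribed by [rho].
    *)
Lemma extend_to_bijection (G : choiceType) (Gam : finType) (E : seq G)
    (rho : G -> Gam) : infinite_set [set: G] -> uniq E ->
  {in E &, injective rho} ->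
  exists (K : {fset G}) (theta : K -> Gam) (theta' : Gam -> K),
    [/\ {subset E <= K}, cancel theta theta', cancel theta' theta &
        forall k : K, val k \in E -> theta k = rho (val k)].
Proof.
move=> iG uE rinj.
pose R := [seq c <- enum Gam | c \notin [seq rho g | g <- E]].
have uR : uniq ([seq rho g | g <- E] ++ R).
  rewrite cat_uniq map_inj_in_uniq// uE filter_uniq ?enum_uniq// andbT /=.
  by apply/hasPn => c; rewrite mem_filter => /andP[].
have allR c : c \in [seq rho g | g <- E] ++ R.
  by rewrite mem_cat mem_filter mem_enum andbT orbN.
have [B BE sB] : exists2 B : seq G, uniq (E ++ B) & size B = size R.
  have iGE : infinite_set ([set: G] `\` [set` E]).
    by apply: infinite_setD.
  have [B BE sB] := infinite_set_fset (size R) iGE.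
  exists (take (size R) (enum_fset B)); last by rewrite size_takel.
  rewrite cat_uniq uE take_uniq ?fset_uniq// andbT /=.
  by apply/hasPn => g /mem_take /BE [_ /= /negP].
(* [nth] needs default values, so the case of an empty [Gam] is apart. *)
have [c0|noc] := pselect (exists c : Gam, True); last first.
  have E0 : E = [::] by case: (E) noc => // g ? []; exists (rho g).
  exists fset0, (fun k : fset0 => rho (val k)).
  have F (c : Gam) : fset0 (K := G) by exfalso; apply: noc; exists c.
  exists F; split; rewrite ?E0// => k; first by case: (k).
  by case: noc; exists k.
case: c0 => c0 _.
pose K := [fset g in E ++ B]%fset.
have KE g : (g \in K) = (g \in E ++ B) by rewrite !inE mem_cat.
have szEB : size (E ++ B) = size ([seq rho g | g <- E] ++ R).
  by rewrite !size_cat size_map sB.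
pose theta (k : K) :=
  nth c0 ([seq rho g | g <- E] ++ R) (index (val k) (E ++ B)).
have [g0 g0P] : exists g0 : G, true.
  by have [g _] := infinite_setN0 iG; exists g.
pose th' (c : Gam) := nth g0 (E ++ B) (index c ([seq rho g | g <- E] ++ R)).
have th'P c : th' c \in K by rewrite KE mem_nth// szEB index_mem allR.
exists K, theta, (fun c => [` th'P c]%fset); split.
- by move=> g gE; rewrite KE mem_cat gE.
- move=> k; apply: val_inj; rewrite /= /th' /theta.
  have kK : val k \in E ++ B by rewrite -KE (valP k).
  by rewrite index_uniq// -?szEB ?index_mem// nth_index.
- move=> c; rewrite /theta /= /th' index_uniq// ?szEB ?index_mem//.
  by rewrite nth_index.
move=> k kE; rewrite /theta index_cat kE nth_cat size_map index_mem kE.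
by rewrite (nth_map (val k)) ?index_mem// nth_index.
Qed.

(** It is enough to represent each finite part of [G] faithfully by maps of a
    finite set [A] to itself: including inverses in the finite part makes
    these maps permutations, and the permutation group of [A] is then the
    finite group that LEF asks for. A finite group needs no representation: it
    is its own finite model. *)
Lemma LEF_of_local_maps (G : groupType) :
  (forall F : seq G, exists (A : finType) (pi : G -> A -> A),
     [/\ pi 1 =1 id,
         {in F &, forall f g, pi (f * g) =1 pi f \o pi g} &
         {in F &, forall f g, pi f =1 pi g -> f = g}]) -> LEF G.
Proof.
move=> loc; have [fG|iG] := pselect (finite_set [set: G]).
  exact: LEF_finite_group.
move=> H.
pose E : seq G := undup (1 :: H ++ [seq h * k | h <- H, k <- H]).
have [A [pi [pi1 piM piI]]] := loc (E ++ [seq h^-1 | h <- E]).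
have EF g : g \in E -> g \in E ++ [seq h^-1 | h <- E].
  by rewrite mem_cat => ->.
have VF g : g \in E -> g^-1 \in E ++ [seq h^-1 | h <- E].
  by move=> gE; rewrite mem_cat map_f// orbT.
have HE g : g \in H -> g \in E.
  by move=> gH; rewrite mem_undup inE mem_cat gH orbT.
have HHE g h : g \in H -> h \in H -> g * h \in E.
  by move=> gH hH; rewrite mem_undup inE mem_cat allpairs_f ?orbT.
have inj g : g \in E -> injective (pi g).
  move=> gE; apply: (@can_inj _ _ _ (pi g^-1)) => y.
  by have := piM _ _ (VF _ gE) (EF _ gE) y; rewrite mulVg pi1.
pose rho g : {perm A} := if insub (finfun (pi g)) is Some s then s else 1.
have rhoE g : g \in E -> rho g =1 pi g.
  move=> gE y; rewrite /rho; case: insubP => [s _ sE|].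
    by rewrite -pvalE sE ffunE.
  case/negP; apply/injectiveP => x z; rewrite !ffunE; exact: inj.
have uE : uniq E by exact: undup_uniq.
have rinj : {in E &, injective rho}.
  move=> g h gE hE gh; apply: piI; rewrite ?EF// => y.
  by rewrite -!rhoE// gh.
have [K [th [th' [EK thK th'K thE]]]] := extend_to_bijection iG uE rinj.
(* The product of permutations applies its left factor first, whereas [pi]
   turns products into compositions: hence the swap. *)
exists K, (fun h k => th' (th k * th h)); split.
- by apply/fsubsetP => g gH; apply: EK; exact: HE.
- split; first by move=> f g h; rewrite !th'K mulgA.
  exists (th' 1), (fun h => th' (th h)^-1).
  by split=> h; rewrite ?th'K ?mulg1 ?mul1g ?mulVg ?mulgV ?thK.
move=> h1 h2 H1 H2.
have kK : val h1 * val h2 \in K by apply: EK; exact: HHE.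
have -> : th' (th h2 * th h1) = [` kK]%fset; last by [].
apply: (can_inj thK); rewrite th'K [RHS]thE /=; last exact: HHE.
rewrite !thE ?HE//; apply/permP => y.
by rewrite permM (rhoE _ (HHE _ _ H1 H2)) !(rhoE _ (HE _ _))// piM ?EF ?HE.
Qed.

End LocalEmbeddings.

(** * Finite models of an action *)

Section FiniteModels.
Local Open Scope classical_set_scope.
Local Open Scope group_scope.
Variables (G : groupType) (X : topologicalType) (alpha : action G X).

(** Finite models of [alpha]: a finite [G]-set, each element [y] of which is
    assigned a point [pt y] of [X], such that up to the finite resolution
    given by [lab] the elements of [E] move the assigned points as they
    should, and every label is seen. The map [pt] need not be equivariant;
    only labels matter. *)
Definition finitely_modelled : Prop :=
  forall (E : seq G) (L : eqType) (lab : X -> L), locally_constant lab ->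
  exists (A : finType) (act : G -> A -> A) (pt : A -> X),
    [/\ act 1 =1 id,
        forall g h, act (g * h) =1 act g \o act h,
        {in E, forall g y, lab (pt (act g y)) = lab (alpha g (pt y))} &
        forall x, exists y, lab (pt y) = lab x].

Lemma actionM g h x : alpha (g * h) x = alpha g (alpha h x).
Proof. by rewrite gmulfM. Qed.

Lemma action1 x : alpha 1 x = x.
Proof. by rewrite gmulf1. Qed.

Lemma actionK g x : alpha g^-1 (alpha g x) = x.
Proof. by rewrite -actionM mulVg action1. Qed.

Lemma free_topologically_free : free_action alpha -> topologically_free alpha.
Proof.
move=> fr g g1; rewrite -subset0 => x /interior_subset /= gx; apply: g1.
exact: fr gx.
Qed.

(** If two locally constant cocycles differ at [x], a fixed nontrivial element
    [g] fixes a whole neighbourhood of [x], against topological freeness. *)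
Lemma cocycle_unique (c d : X -> G) : topologically_free alpha ->
  locally_constant c -> locally_constant d ->
  (forall x, alpha (c x) x = alpha (d x) x) -> c =1 d.
Proof.
move=> tf cc dc cd x; apply: contrapT => ncd.
have dc1 : (d x)^-1 * c x <> 1.
  by move=> /(congr1 (fun k => d x * k)); rewrite mulVKg mulg1.
have : interior [set y | alpha ((d x)^-1 * c x) y = y] x.
  apply: filterS2 (cc x) (dc x) => y cy dy /=.
  by rewrite actionM -cy cd dy actionK.
by rewrite tf.
Qed.

Lemma full_group_cocycle (f : topological_full_group alpha) :
  exists c : X -> G,
    locally_constant c /\ forall x, val f x = alpha (c x) x.
Proof.
have /asboolP[c /continuous_discreteP cc fc] := valP f.
by exists c.
Qed.

(** An element [f] of the full group acts by [f x = c_f(x) x] with [c_f]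
    locally constant. In a finite model, put [pi_f y = c_f(pt y) y]. If the
    labels record all the relevant [c_f], then [pi] inherits the cocycle
    identity [c_(f g)(x) = c_f(g x) c_g(x)] and is multiplicative on a finite
    set [F]; if they also record enough clopen sets to tell the elements of
    [F] apart, then [pi] is injective on [F]. *)
Theorem LEF_full_group : compact [set: X] -> zero_dimensional X ->
  topologically_free alpha -> finitely_modelled ->
  LEF (topological_full_group alpha).
Proof.
move=> cX zX tf fm; apply: LEF_of_local_maps => F.
have [c cP] := choice full_group_cocycle.
have cc f : locally_constant (c f) by case: (cP f).
have fc (f : topological_full_group alpha) x : val f x = alpha (c f x) x.
  by case: (cP f).
have cM (f g : topological_full_group alpha) x :
    c (f * g) x = c f (val g x) * c g x.
  move: x; apply: (cocycle_unique tf) => //.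
    have gcont : continuous (val g) by case: (homeoP (val g)).
    apply: (@locally_constant_comp _ _ _ (fun p => p.1 * p.2)
      (fun x => (c f (val g x), c g x))).
    apply: locally_constant_pair => //.
    exact: (locally_constant_precomp gcont).
  by move=> x; rewrite -fc actionM -!fc.
have c1 x : c 1 x = 1.
  move: x; apply: (cocycle_unique tf) => //.
    by move=> x; exact: nearW.
  by move=> x; rewrite -fc action1.
have sepP (fg : topological_full_group alpha * topological_full_group alpha) :
    exists s : X -> bool, locally_constant s /\ (fg.1 <> fg.2 ->
      exists x, s (val fg.1 x) <> s (val fg.2 x)).
  case: fg => f g /=; have [->|fg] := pselect (f = g).
    by exists (fun=> true); split => // x; exact: nearW.
  have [x fgx] : exists x, val f x <> val g x.
    apply: contrapT => /forallNP fg'; apply: fg; apply: val_inj.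
    by apply: homeo_ext => x; apply: contrapT; exact: fg'.
  have [U [cU Uf Ug]] := zX (val f x) (val g x) (introN eqP fgx).
  exists (fun y => `[< U y >]); split; first exact: clopen_locally_constant.
  by move=> _; exists x; rewrite (asboolT Uf) (asboolF Ug).
(* [s (f, g)] is the indicator of a clopen set separating [f x] from [g x] for
   some [x]. *)
have [s sP] := choice sepP.
have sc fg : locally_constant (s fg) by case: (sP fg).
have sD fg : fg.1 <> fg.2 -> exists x, s fg (val fg.1 x) <> s fg (val fg.2 x).
  by case: (sP fg).
(* The separating functions are recorded at [x], [f x] and [g x], so that the
   value of [s] at [pt (pi_f y)] can be compared with that at [f (pt y)]. *)
pose FF := [seq (f, g) | f <- F, g <- F].
pose lab x := ([seq c f x | f <- F],
  [seq (s fg x, s fg (val fg.1 x), s fg (val fg.2 x)) | fg <- FF]).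
have labc : locally_constant lab.
  apply: locally_constant_pair; apply: locally_constant_map => // fg.
  apply: locally_constant_pair; first apply: locally_constant_pair => //.
    apply: (locally_constant_precomp _ (sc fg)).
    by case: (homeoP (val fg.1)).
  apply: (locally_constant_precomp _ (sc fg)).
  by case: (homeoP (val fg.2)).
have labC f x y : f \in F -> lab x = lab y -> c f x = c f y.
  by move=> fF [/eq_in_map/(_ f fF)].
have labS fg x y : fg \in FF -> lab x = lab y -> [/\ s fg x = s fg y,
    s fg (val fg.1 x) = s fg (val fg.1 y) &
    s fg (val fg.2 x) = s fg (val fg.2 y)].
  by move=> fF [_ /eq_in_map/(_ fg fF)[]].
have [pts ptsP] := locally_constant_finite_range cX labc.
pose E := [seq c f p | f <- F, p <- pts].
have cE f x : f \in F -> c f x \in E.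
  move=> fF; have [p ppts xp] := ptsP x.
  by rewrite (labC f _ _ fF xp) allpairs_f.
have [A [act [pt [act1 actM actE surj]]]] := fm E _ _ labc.
exists A, (fun f y => act (c f (pt y)) y).
have lab_step f y : f \in F ->
    lab (pt (act (c f (pt y)) y)) = lab (val f (pt y)).
  by move=> fF; rewrite actE ?cE// fc.
split.
- by move=> y; rewrite c1 act1.
- move=> f g fF gF y /=; rewrite cM actM /=; congr act; apply: esym.
  by apply: (labC) => //; exact: lab_step.
move=> f g fF gF fg; apply: contrapT => nfg.
have fgF : (f, g) \in FF by exact: allpairs_f.
have [x] := sD (f, g) nfg; apply => /=.
have [y /(labS _ _ _ fgF)[_ /= <- <-]] := surj x.
have [<- _ _] := labS _ _ _ fgF (lab_step f y fF).
have [<- _ _] := labS _ _ _ fgF (lab_step g y gF).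
by rewrite (fg y).
Qed.

End FiniteModels.

(** * Free groups acting on finite sets *)

Section FreeGroupActions.
Local Open Scope group_scope.
Variables (B : choiceType) (T : finType) (sigma : B -> {perm T}).

Definition letter_act (l : letter B) : {perm T} :=
  if l.2 then (sigma l.1)^-1 else sigma l.1.

Definition word_act (w : seq (letter B)) (y : T) : T :=
  foldr (fun l z => letter_act l z) y w.

(** The universal property of the free group: permutations of [T] assigned to
    the generators extend to an action. Letters are applied from the right end
    of a word, which makes this a left action. *)
Definition free_act (g : free_group B) : T -> T := word_act (val g).

Lemma letter_actK l : cancel (letter_act (linv l)) (letter_act l).
Proof. by case: l => b [] y; rewrite /letter_act /= ?permK ?permKV. Qed.

Lemma word_act_cat u v y : word_act (u ++ v) y = word_act u (word_act v y).
Proof. by rewrite /word_act foldr_cat. Qed.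

Lemma word_act_reduce w y : word_act (reduce w) y = word_act w y.
Proof.
elim: w => //= l w <-; case: (reduce w) => //= m u.
by case: ifP => //= /eqP ->; rewrite letter_actK.
Qed.

Lemma free_act1 : free_act 1 =1 id.
Proof. by move=> y; rewrite /free_act. Qed.

Lemma free_actM g h : free_act (g * h) =1 free_act g \o free_act h.
Proof. by move=> y; rewrite /free_act /= word_act_reduce word_act_cat. Qed.

End FreeGroupActions.

(** * Rational approximation of positive weights *)

Section Sampling.
Local Open Scope ring_scope.
Variable R : realType.

(** A linear system with rational coefficients that has a positive real
    solution has a positive rational one: its solution space has a basis of
    rational vectors, in which the real solution [v] has coordinates [w];
    rational numbers close enough to [w] keep every entry positive. *)
Lemma rational_positive_solution m n (M : 'M[rat]_(m, n)) (v : 'rV[R]_m) :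
  (forall i, 0 < v 0 i) -> v *m map_mx ratr M = 0 ->
  exists2 u : 'rV[rat]_m, (forall i, 0 < u 0 i) & u *m M = 0.
Proof.
move=> v0 /eqP vM.
have : (v <= map_mx ratr (kermx M))%MS by rewrite map_kermx sub_kermx.
move=> /submxP[w vE]; set K := kermx M in vE.
have [d d0 dv] : exists2 d, 0 < d & forall i, d <= v 0 i.
  exists (\big[Num.min/1]_i v 0 i).
    by apply: lt_bigmin => // i _; exact: v0.
  by move=> i; apply: bigmin_le_cond.
pose C : R := 1 + \sum_i \sum_j `|ratr (K i j)|.
have C0 : 0 < C.
  by rewrite ltr_pwDl// sumr_ge0// => i _; rewrite sumr_ge0.
have qP i : exists q : rat, `|ratr q - w 0 i| < d / C.
  have /rat_in_itvoo[q] : w 0 i - d / C < w 0 i + d / C.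
    by rewrite ltrBlDr -addrA ltrDl addr_gt0// divr_gt0.
  by rewrite in_itv /= -ltr_distl => qw; exists q.
have [q qw] := choice qP.
exists (\row_i q i *m K); last by rewrite -mulmxA mulmx_ker mulmx0.
move=> j; rewrite -(ltr0q R).
have -> : ratr ((\row_i q i *m K) 0 j) =
    v 0 j + \sum_i (ratr (q i) - w 0 i) * ratr (K i j) :> R.
  rewrite vE !mxE rmorph_sum -big_split /=; apply: eq_bigr => i _.
  by rewrite !mxE rmorphM /= -mulrDl addrC subrK.
set e := \sum_i _.
suff : `|e| < d by rewrite ltr_norml => /andP[de _]; have := dv j; lra.
apply: (@le_lt_trans _ _ (d / C * \sum_i `|ratr (K i j)|)).
  rewrite mulr_sumr; apply: (le_trans (ler_norm_sum _ _ _)).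
  apply: ler_sum => i _; rewrite normrM ler_wpM2r//; exact: ltW.
rewrite mulrAC -mulrA gtr_pMr// ltr_pdivrMr// mul1r.
apply: (@le_lt_trans _ _ (\sum_i \sum_j `|ratr (K i j)| : R)).
  apply: ler_sum => i _; rewrite (bigD1 j)//= lerDl sumr_ge0//.
by rewrite /C ltrDr.
Qed.

(** Clear denominators in a rational solution. *)
Lemma natural_positive_solution m n (M : 'M[rat]_(m, n)) (v : 'rV[R]_m) :
  (forall i, 0 < v 0 i) -> v *m map_mx ratr M = 0 ->
  exists2 k : 'I_m -> nat, (forall i, 0 < k i)%N &
    forall j, \sum_i (k i)%:R * M i j = 0.
Proof.
move=> v0 vM; have [u u0 uM] := rational_positive_solution v0 vM.
pose D : rat := \prod_i (denq (u 0 i))%:~R.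
have D0 : 0 < D by apply: prodr_gt0 => i _; rewrite ltr0z.
have kP i : exists k : nat, u 0 i * D = k%:R.
  have Dn : forall P : pred 'I_m, exists k : nat,
      \prod_(j | P j) (denq (u 0 j))%:~R = k%:R :> rat.
    move=> P; elim/big_rec: _ => [|j x _ [k ->]]; first by exists 1%N.
    exists (`|denq (u 0%R j)| * k)%N.
    by rewrite natrM -[in LHS](gtz0_abs (denq_gt0 _)).
  have [k kE] := Dn (fun j => j != i); exists (`|numq (u 0%R i)| * k)%N.
  rewrite /D (bigD1 i)//= kE mulrA natrM; congr (_ * _).
  rewrite -[X in X * _]divq_num_den divfK ?intr_eq0 ?denq_neq0//.
  by rewrite -[in LHS](@gtz0_abs (numq _)) ?numq_gt0.
have [k kE] := choice kP; exists k.
  by move=> i; rewrite -(ltr0n rat) -kE mulr_gt0.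
move=> j; have := congr1 (fun A : 'rV_n => A 0 j * D) uM.
rewrite !mxE mul0r mulr_suml => E; rewrite -[RHS]E; apply: eq_bigr => i _.
by rewrite -kE mulrAC.
Qed.

(** Positive weights [v] for which [lab0] and every [lab j] have the same
    distribution can be replaced by positive integers, since equality of
    distributions is a linear system with coefficients -1, 0 and 1. Repeating
    each [i] that many times yields a sample on which the distributions agree
    exactly. *)
Lemma balanced_sample (I J : finType) (L : eqType) (v : I -> R)
    (lab0 : I -> L) (lab : J -> I -> L) :
  (forall i, 0 < v i) ->
  (forall j p, \sum_(i | lab0 i == p) v i = \sum_(i | lab j i == p) v i) ->
  exists s : seq I, (forall i, i \in s) /\
    forall j, perm_eq [seq lab0 i | i <- s] [seq lab j i | i <- s].
Proof.
move=> v0 vlab.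
(* One equation for each [j] and each value [lab0 i] of [lab0]. *)
pose c (i : I) (jp : J * I) : rat :=
  (lab0 i == lab0 jp.2)%:R - (lab jp.1 i == lab0 jp.2)%:R.
pose M : 'M[rat]_(#|I|, #|{: J * I}|) :=
  \matrix_(i, jp) c (enum_val i) (enum_val jp).
have [||k k0 kM] := @natural_positive_solution _ _ M (\row_i v (enum_val i)).
- by move=> i; rewrite mxE.
- apply/rowP => jp; rewrite /M !mxE.
  under eq_bigr do rewrite !mxE.
  rewrite -(@reindex _ _ _ _ _ enum_val predT
      (fun i => v i * ratr (c i (enum_val jp)))) /=; last first.
    by apply: onW_bij; exact: enum_val_bij.
  under eq_bigr do rewrite /c rmorphB /= !ratr_nat mulrBr.
  rewrite sumrB; apply/eqP; rewrite subr_eq0; apply/eqP.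
  have E (f : I -> L) p : \sum_i v i * (f i == p)%:R = \sum_(i | f i == p) v i.
    by rewrite [RHS]big_mkcond; apply: eq_bigr => i _; case: eqP => _;
      rewrite ?mulr1 ?mulr0.
  by rewrite !E.
pose s := flatten [seq nseq (k (enum_rank i)) i | i <- enum I].
have cs (f : I -> L) p :
    count_mem p [seq f i | i <- s] = (\sum_i k (enum_rank i) * (f i == p))%N.
  rewrite -(big_enum _ _ _ (fun i => k (enum_rank i) * (f i == p))%N) /= /s.
  elim: (enum I) => [|i e IH]; first by rewrite big_nil.
  rewrite big_cons /= map_cat count_cat IH; congr addn.
  by rewrite map_nseq count_nseq mulnC.
exists s; split.
  move=> i; apply/flatten_mapP; exists i; first by rewrite mem_enum.
  by rewrite mem_nseq eqxx andbT.
move=> j; apply/allP => p _ /=; rewrite !cs; apply/eqP.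
(* A label [p] that [lab0] misses has total weight zero, so positivity of the
   weights prevents [lab j] from taking it. *)
have [[i0 <-]|np] := pselect (exists i0, lab0 i0 = p).
  have : \sum_i (k i)%:R * c (enum_val i) (j, i0) = 0.
    rewrite -[RHS](kM (enum_rank (j, i0))).
    by apply: eq_bigr => i _; rewrite mxE enum_rankK.
  under [X in X = 0 -> _]eq_bigr do rewrite /c /= mulrBr -!natrM.
  rewrite sumrB => /eqP; rewrite subr_eq0 -!natr_sum eqr_nat => /eqP.
  rewrite (reindex enum_rank) /=; last by apply: onW_bij; exact: enum_rank_bij.
  rewrite [RHS](reindex enum_rank) /=; last first.
    by apply: onW_bij; exact: enum_rank_bij.
  by under eq_bigr do rewrite enum_rankK;
     under [in RHS]eq_bigr do rewrite enum_rankK.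
rewrite big1 ?big1// => i _; last first.
  by case: eqP => [E|]; rewrite ?muln0//; case: np; exists i.
case: eqP => [E|]; rewrite ?muln0//; exfalso.
have := vlab j p; rewrite big_pred0; last first.
  by move=> i1; apply/eqP => E1; apply: np; exists i1.
rewrite (bigD1 i) ?E//= => /esym/eqP; rewrite gt_eqF// ltr_pwDl//.
by rewrite sumr_ge0// => i1 _; exact: ltW.
Qed.

End Sampling.

(** * Invariant measures *)

Section BorelMeasure.
Local Open Scope classical_set_scope.
Local Open Scope group_scope.
Variables (R : realType) (X : ptopologicalType) (mu : probability (borel X) R).

Lemma open_borel (U : set X) : open U -> measurable (U : set (borel X)).
Proof. exact: sub_sigma_algebra. Qed.

(** By minimality and compactness finitely many translates of [U] cover [X];
    by invariance they would all be null if [U] were. *)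
Lemma open_measure_gt0 (G : groupType) (alpha : action G X) (U : set X) :
  compact [set: X] -> minimal alpha -> invariant_probability alpha mu ->
  open U -> U !=set0 -> (0 < mu (U : set (borel X)))%E.
Proof.
move=> cX mX imu oU U0; rewrite lt0e measure_ge0 andbT; apply/eqP => U00.
have contg (g : G) : continuous (alpha g) by case: (homeoP (alpha g)).
have [s sP] : exists s : seq G, forall y, exists2 g, g \in s & U (alpha g y).
  apply: compact_finite_witnesses => // x.
  have [y [Uy [g _ gx]]] := mX x U U0 oU; exists g.
  by apply: contg; rewrite gx; exact: open_nbhs_nbhs.
have negl (g : G) : mu.-negligible (alpha g @^-1` U : set (borel X)).
  apply/negligibleP.
    by apply: open_borel; apply: open_comp => // x _; exact: contg.
  by have := imu g _ (open_borel oU); rewrite U00.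
have ns : mu.-negligible
    (\big[setU/set0]_(g <- s) (alpha g @^-1` U) : set (borel X)).
  elim: (s) => [|g s' IH]; first by rewrite big_nil; exact: negligible_set0.
  by rewrite big_cons; exact: negligibleU.
have /negligibleP : mu.-negligible (setT : set (borel X)).
  apply: negligibleS ns => x _; have [g gs Ux] := sP x.
  by rewrite -bigcup_seq; exists g.
move=> /(_ measurableT) muT0; have := probability_setT mu.
by rewrite [X in X = _]muT0 => -[] /esym/eqP; rewrite oner_eq0.
Qed.

(** The fibers of the finer function [t] are indexed by representatives [rep],
    and each fiber of [f] is the disjoint union of the fibers of [t] inside
    it. *)
Lemma measure_fibers (L M : eqType) (t : X -> L) (f : X -> M) n
    (rep : 'I_n -> X) (p : M) :
  locally_constant t -> injective (t \o rep) ->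
  (forall x, exists i, t x = t (rep i)) ->
  (forall x y, t x = t y -> f x = f y) ->
  (\sum_(i < n | f (rep i) == p)
      fine (mu ([set x | t x = t (rep i)] : set (borel X))))%R
    = fine (mu ([set x | f x = p] : set (borel X))).
Proof.
move=> tc tI trep tf; pose F i : set (borel X) := [set x | t x = t (rep i)].
have mt i : measurable (F i).
  exact: open_borel (locally_constant_open_preimage [set t (rep i)] tc).
have mf : measurable ([set x | f x = p] : set (borel X)).
  apply: open_borel.
  have -> : [set x | f x = p] = t @^-1` [set l | exists2 y, f y = p & t y = l].
    apply/seteqP; split=> x /=; first by move=> <-; exists x.
    by case=> y <- /tf.
  exact: locally_constant_open_preimage.
apply: EFin_inj; rewrite -sumEFin fineK ?fin_num_measure//.
rewrite (eq_bigr (fun i => mu (F i))); last first.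
  by move=> i _; rewrite fineK//; apply: fin_num_measure; exact: mt.
rewrite -(@measure_bigsetU_ord _ _ _ mu _ (fun i => f (rep i) == p) F)//.
  congr (mu _); apply/seteqP; split=> x /=.
    by elim/big_ind: _ => //= [A B HA HB []//|i /eqP <- /tf].
  have [i xi] := trep x; move=> fx; rewrite (bigD1 i) /=; first by left.
  by rewrite -(tf _ _ xi) fx.
by move=> i j _ _ [x [/= xi xj]]; apply: tI; rewrite /= -xi xj.
Qed.

End BorelMeasure.

(** * Finite models of free group actions *)

Section FreeGroupModels.
Local Open Scope classical_set_scope.
Local Open Scope group_scope.
Variables (B : choiceType).
Local Notation F := (free_group B).

Definition generator (b : B) : F := fg_mk [:: (b, false)].

Lemma fg_mk_cat u v : fg_mk (u ++ v) = fg_mk u * fg_mk v :> F.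
Proof. by apply: val_inj; rewrite /= reduce_catl reduce_catr. Qed.

Lemma fg_mk_nil : fg_mk [::] = 1 :> F.
Proof. exact: val_inj. Qed.

Lemma fg_mk_val (g : F) : fg_mk (val g) = g.
Proof. by apply: val_inj; rewrite /= reduce_id// (valP g). Qed.

Lemma fg_mk_inverse_letter (b : B) : fg_mk [:: (b, true)] = (generator b)^-1.
Proof. exact: val_inj. Qed.

Definition prefixes (g : F) : seq F :=
  [seq fg_mk (take i (val g)) | i <- iota 0 (size (val g)).+1].

Variables (X : topologicalType) (alpha : action F X).

(** In a free group, it suffices to build models in which the generators, one
    at a time, move labels correctly: as there are no relations to satisfy,
    any permutations generate an action. To follow a word [g] letter by
    letter, the labels must show where each point goes under every prefix of
    [g]; the part of the window used shrinks by one letter at each step. For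
    an inverse letter [b^-1] after the prefix [v], the condition on [b] is
    used at the longer prefix [v b^-1] and read backwards. *)
Lemma finitely_modelled_free_group :
  (forall (S : seq B) (L : eqType) (lab : X -> L), locally_constant lab ->
    exists (A : finType) (sigma : B -> {perm A}) (pt : A -> X),
    {in S, forall b y,
      lab (pt (sigma b y)) = lab (alpha (generator b) (pt y))} /\
    forall x, exists y, lab (pt y) = lab x) ->
  finitely_modelled alpha.
Proof.
move=> gm E L lab labc.
pose W : seq F := flatten [seq prefixes g | g <- 1 :: E].
pose S : seq B := flatten [seq [seq l.1 | l <- val g] | g <- E].
pose lab' x := [seq lab (alpha h x) | h <- W].
have contg (g : F) : continuous (alpha g) by case: (homeoP (alpha g)).
have labc' : locally_constant lab'.
  apply: locally_constant_map => h.
  exact: locally_constant_precomp (contg h) labc.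
have lab'P h x y : h \in W -> lab' x = lab' y ->
    lab (alpha h x) = lab (alpha h y).
  by move=> hW /eq_in_map; exact.
have [A [sigma [pt [sigmaE surj]]]] := gm S _ _ labc'.
exists A, (free_act sigma), pt; split.
- exact: free_act1.
- exact: free_actM.
- have step v l z : l.1 \in S -> fg_mk v \in W -> fg_mk (rcons v l) \in W ->
      lab (alpha (fg_mk v) (pt (letter_act sigma l z))) =
      lab (alpha (fg_mk (rcons v l)) (pt z)).
    case: l => b [] /= bS vW vlW.
      have /(lab'P _ _ _ vlW) := sigmaE b bS ((sigma b)^-1 z).
      rewrite -[X in sigma b X]/((letter_act sigma (linv (b, false))) z).
      rewrite (letter_actK sigma (b, false) z) => ->.
      by rewrite -actionM -cats1 fg_mk_cat fg_mk_inverse_letter mulgVK.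
    rewrite (lab'P _ _ _ vW (sigmaE b bS z)) -actionM.
    by rewrite -cats1 fg_mk_cat.
  move=> g gE y; set w := val g.
  have wW i : (i <= size w)%N -> fg_mk (take i w) \in W.
    move=> iw; apply/flatten_mapP; exists g; first by rewrite inE gE orbT.
    by apply/mapP; exists i; rewrite // mem_iota.
  have wS l : l \in w -> l.1 \in S.
    move=> lw; apply/flatten_mapP; exists g => //.
    by apply/mapP; exists l.
  have IH i : (i <= size w)%N ->
      lab (alpha (fg_mk (take i w)) (pt (word_act sigma (drop i w) y))) =
      lab (pt (free_act sigma g y)).
    elim: i => [_|i IH iw].
      rewrite take0 drop0.
      by rewrite fg_mk_nil action1.
    rewrite -{}IH; last exact: ltnW.
    case Ew : (w) (iw) => [//|l0 w0] _.
    rewrite -Ew (take_nth l0 iw) (drop_nth l0 iw) -step//.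
    + by apply: wS; exact: mem_nth.
    + by apply: wW; exact: ltnW.
    by rewrite -take_nth// wW.
  by rewrite -(IH _ (leqnn _)) take_size drop_size /= fg_mk_val.
- move=> x; have [y xy] := surj x; exists y.
  have W1 : (1 : F) \in W.
    apply/flatten_mapP; exists 1; first by rewrite inE eqxx.
    by apply/mapP; exists 0%N => //; exact: val_inj.
  by have := lab'P _ _ _ W1 xy; rewrite !action1.
Qed.

End FreeGroupModels.

Section MeasureModels.
Local Open Scope classical_set_scope.
Local Open Scope group_scope.
Variables (R : realType) (G : groupType) (X : ptopologicalType).
Variables (alpha : action G X) (mu : probability (borel X) R).

(** How the measure is used. By invariance, [lab] at [x] and [lab] at [gen b
    x] have the same distribution. The atoms of the partition on which all
    these functions are constant have positive measure, so [balanced_sample]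
    gives a finite sample of points in which the labels of the points [y] and
    those of the points [gen b y] form the same multiset, for each [b]. A
    permutation matching the two multisets is a model of the generator. *)
Lemma sample_with_permutations (B : choiceType) (gen : B -> G) (S : seq B)
    (L : eqType) (lab : X -> L) :
  compact [set: X] -> minimal alpha -> invariant_probability alpha mu ->
  locally_constant lab ->
  exists (A : finType) (sigma : B -> {perm A}) (pt : A -> X),
    {in S, forall b y, lab (pt (sigma b y)) = lab (alpha (gen b) (pt y))} /\
    forall x, exists y, lab (pt y) = lab x.
Proof.
move=> cX mX imu labc.
have contg (g : G) : continuous (alpha g) by case: (homeoP (alpha g)).
pose t x := (lab x, [seq lab (alpha (gen b) x) | b <- S]).
have tc : locally_constant t.
  apply: locally_constant_pair => //; apply: locally_constant_map => b.
  exact: locally_constant_precomp (contg _) labc.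
have [pts ptsP] := locally_constant_finite_range cX tc.
pose vals := undup [seq t p | p <- pts].
have repP (i : 'I_(size vals)) : exists x, t x = tnth (in_tuple vals) i.
  have := mem_tnth i (in_tuple vals); rewrite mem_undup => /mapP[x _ ->].
  by exists x.
have [rep repE] := choice repP.
have repI : injective (t \o rep).
  move=> i j /=; rewrite !repE; apply/tuple_uniqP; exact: undup_uniq.
have repS x : exists i, t x = t (rep i).
  have [p pp ->] := ptsP x.
  have /(@tnthP _ _ (in_tuple vals))[i ti] : t p \in vals.
    by rewrite mem_undup map_f.
  by exists i; rewrite repE.
pose F i : set (borel X) := [set x | t x = t (rep i)].
have oF i : open (F i).
  exact: (locally_constant_open_preimage [set t (rep i)] tc).
have mF i : measurable (F i) by exact: open_borel.
have tlab x y : t x = t y -> lab x = lab y by case.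
have tlabS b x y : b \in S -> t x = t y ->
    lab (alpha (gen b) x) = lab (alpha (gen b) y).
  by move=> bS [_ /eq_in_map/(_ b bS)].
have [|j p|s [sall sperm]] := @balanced_sample R
    'I_(size vals) (seq_sub S) L (fun i => fine (mu (F i)))
    (fun i => lab (rep i)) (fun b i => lab (alpha (gen (val b)) (rep i))).
- move=> i; apply: fine_gt0; rewrite ltey_eq fin_num_measure// andbT.
  by apply: (open_measure_gt0 cX mX imu) => //; exists (rep i).
- rewrite (measure_fibers mu p tc repI repS tlab).
  rewrite (@measure_fibers _ _ mu _ _ t (fun x => lab (alpha (gen (val j)) x)) _
    rep p tc repI repS); last by move=> x y; apply: tlabS; exact: valP j.
  congr fine; have /= <- // := imu (gen (val j)) [set x | lab x = p].
  apply: open_borel; exact: (locally_constant_open_preimage [set p] labc).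
have sP (b : B) : exists sg : 'S_(size s), b \in S -> forall y,
    lab (rep (tnth (in_tuple s) (sg y))) =
    lab (alpha (gen b) (rep (tnth (in_tuple s) y))).
  have [bS|_] := boolP (b \in S); last by exists 1.
  have := sperm (SeqSub bS); rewrite perm_sym.
  have := @tuple_permP _ _ [seq lab (alpha (gen b) (rep i)) | i <- s]
    [tuple of [seq lab (rep i) | i <- in_tuple s]].
  move=> /rwP[_ h] /h [sg sgE]; exists sg => _ y.
  have /(congr1 (fun u => nth (lab (rep (tnth (in_tuple s) y))) u y)) := sgE.
  rewrite (nth_map (tnth (in_tuple s) y))// -tnth_nth.
  rewrite -[X in _ = nth _ X _ -> _]/(tval [tuple _ | i < _]).
  rewrite -tnth_nth tnth_mktuple tnth_map => <-.
  by rewrite -(tnth_nth _ (in_tuple s)).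
have [sigma sigmaP] := choice sP.
exists 'I_(size s), sigma, (fun y => rep (tnth (in_tuple s) y)); split.
  by move=> b bS y; exact: sigmaP.
move=> x; have [i xi] := repS x.
have /(@tnthP _ _ (in_tuple s))[y yi] := sall i.
by exists y; rewrite -yi; apply/esym; exact: tlab.
Qed.

End MeasureModels.

Section MeasureLEF.
Local Open Scope classical_set_scope.

Lemma LEF_of_invariant_measure (R : realType) (B : choiceType)
    (X : ptopologicalType) (alpha : action (free_group B) X)
    (mu : probability (borel X) R) :
  compact [set: X] -> zero_dimensional X -> minimal alpha ->
  topologically_free alpha -> invariant_probability alpha mu ->
  LEF (topological_full_group alpha).
Proof.
move=> cX zX mX tX imu; apply: LEF_full_group => //.
apply: finitely_modelled_free_group => S L lab labc.
exact: (@sample_with_permutations R _ X alpha mu B (@generator B) S L lab).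
Qed.

Lemma homeomorphic_cantor (X : topologicalType) :
  homeomorphic X cantor_space -> compact [set: X] /\ zero_dimensional X.
Proof.
move=> [f [g [fc gc fK gK]]]; split.
  have -> : [set: X] = g @` [set: cantor_space].
    by apply/seteqP; split=> x // _; exists (f x).
  apply: continuous_compact; last exact: cantor_space_compact.
  exact: continuous_subspaceT.
move=> x y /eqP xy.
have fxy : f x != f y by apply/eqP => /(congr1 g); rewrite !fK.
have [U [[oU cU] Ux Uy]] := cantor_zero_dimensional fxy.
exists (f @^-1` U); split => //; split.
  by apply: open_comp => // z _; exact: fc.
by apply: closed_comp => // z _; exact: fc.
Qed.

End MeasureLEF.

(** * Finite-index subgroups and residual finiteness *)

Section FiniteIndex.
Local Open Scope classical_set_scope.
Local Open Scope group_scope.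
Variable G : groupType.

Definition mk_group (S : {pred G}) (SP : group_closed S) : groupClosed G :=
  HB.pack_for (groupClosed G) S
    (isMul1Closed.Build G S (fst SP))
    (isMulClosed.Build G S (group_closedM SP))
    (isInvClosed.Build G S (group_closedV SP)).

Definition normal_subgroup (K : groupClosed G) : Prop :=
  forall k g, k \in K -> g * k * g^-1 \in K.

(** Finite index is obtained from any finite-valued invariant fine enough to
    separate the left cosets of [K]. *)
Lemma finite_index_of_invariant (K : groupClosed G) (T : Type) (phi : G -> T) :
  finite_set (range phi) ->
  (forall g h, phi g = phi h -> g^-1 * h \in K) -> finite_index K.
Proof.
move=> fphi phiK.
pose psi t := [set k | exists2 g, phi g = t & g^-1 * k \in K].
rewrite /finite_index.
have -> : (fun g => [set k | g^-1 * k \in K]) = psi \o phi.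
  apply/funext => g; apply/seteqP; split=> k /=; first by exists g.
  case=> h /esym/phiK gh hk.
  by rewrite -(mulVKg h k) mulgA gpredM.
by rewrite -image_comp; exact: finite_image.
Qed.

Lemma finite_index_reps (K : groupClosed G) : finite_index K ->
  exists s : seq G, forall g, exists2 r, r \in s & r^-1 * g \in K.
Proof.
move=> /finite_seqP[S SE].
have repP (c : set G) : exists r : G,
    (exists g, c = [set k | g^-1 * k \in K]) -> c = [set k | r^-1 * k \in K].
  have [[r ->]|nr] := pselect (exists g, c = [set k | g^-1 * k \in K]).
    by exists r.
  by exists 1 => /nr.
have [rep repE] := choice repP.
exists [seq rep c | c <- S] => g.
pose c := [set k | g^-1 * k \in K].
exists (rep c).
  apply: map_f.
  have : range (fun g : G => [set k | g^-1 * k \in K]) c by exists g.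
  by rewrite SE.
have : c g by rewrite /c /= mulVg gpred1.
by rewrite [X in X g](repE c) //; exists g.
Qed.

Lemma groupT_subproof : group_closed (fun _ : G => true).
Proof. by split. Qed.
Definition groupT : groupClosed G := mk_group groupT_subproof.

Lemma groupI_subproof (K L : groupClosed G) :
  group_closed (fun g : G => (g \in K) && (g \in L)).
Proof.
split; first by rewrite unfold_in !gpred1.
move=> g h; rewrite !unfold_in => /andP[gK gL] /andP[hK hL].
by apply/andP; split; apply: gpredF.
Qed.
Definition groupI (K L : groupClosed G) : groupClosed G :=
  mk_group (groupI_subproof K L).

Lemma in_groupI K L g : (g \in groupI K L) = (g \in K) && (g \in L).
Proof. by []. Qed.

Lemma finite_indexT : finite_index groupT.
Proof.
exact: (@finite_index_of_invariant _ _ (fun=> tt)).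
Qed.

Lemma finite_indexI K L :
  finite_index K -> finite_index L -> finite_index (groupI K L).
Proof.
move=> fK fL; apply: (@finite_index_of_invariant _ _ (fun g : G =>
  ([set k | g^-1 * k \in K], [set k | g^-1 * k \in L]))).
  by apply: sub_finite_set (finite_setX fK fL) => _ [g _ <-]; split; exists g.
move=> g h [gK gL]; rewrite in_groupI.
have [K1 L1] : [set k | h^-1 * k \in K] h /\ [set k | h^-1 * k \in L] h.
  by rewrite /= !mulVg !gpred1.
by rewrite -gK in K1; rewrite -gL in L1; apply/andP.
Qed.

Lemma normal_subgroupI K L :
  normal_subgroup K -> normal_subgroup L -> normal_subgroup (groupI K L).
Proof.
by move=> nK nL k g; rewrite !in_groupI => /andP[kK kL]; rewrite nK ?nL.
Qed.

Definition residually_finite : Prop := forall w : G, w <> 1 ->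
  exists K : groupClosed G, [/\ normal_subgroup K, finite_index K & w \notin K].

Lemma residually_finite_of_actions :
  (forall w : G, w <> 1 -> exists (A : finType) (act : G -> A -> A),
    [/\ act 1 =1 id, forall g h, act (g * h) =1 act g \o act h &
        exists y, act w y <> y]) ->
  residually_finite.
Proof.
move=> acts w /acts[A [act [act1 actM' [y wy]]]].
have actM g h z : act (g * h) z = act g (act h z) := actM' g h z.
pose S : {pred G} := fun g => [forall z, act g z == z].
have SP g : reflect (forall z, act g z = z) (g \in S).
  by apply: (iffP forallP) => gz z; apply/eqP.
have Sc : group_closed S.
  split; first by apply/SP => z; rewrite act1.
  move=> g h /SP gz /SP hz; apply/SP => z.
  by rewrite actM -[in act h^-1 _](hz z) -[act h^-1 _]actM mulVg act1 gz.
have inS g : (g \in mk_group Sc) = (g \in S) by [].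
exists (mk_group Sc); split.
- move=> k g; rewrite !inS => /SP kz; apply/SP => z.
  by rewrite !actM kz -actM mulgV act1.
- apply: (@finite_index_of_invariant _ _ (fun g => finfun (act g))).
    exact: finite_finset.
  move=> g h /ffunP gh; rewrite inS; apply/SP => z.
  have := gh z; rewrite !ffunE => ghz.
  by rewrite actM -ghz -actM mulVg act1.
by rewrite inS; apply/SP => /(_ y).
Qed.

Lemma countable_enumeration (T : Type) (t0 : T) : countable [set: T] ->
  exists e : nat -> T, forall u, exists n, e n = u.
Proof.
move=> /countable_injP[f fI].
have eP (n : nat) : exists u, forall u', f u' = n -> u = u'.
  have [[u un]|nou] := pselect (exists u, f u = n); last first.
    by exists t0 => u' u'n; case: nou; exists u'.
  by exists u => u' u'n; apply: fI; rewrite ?inE// un.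
by have [e eE] := choice eP; exists e => u; exists (f u); exact: eE.
Qed.

(** Intersect step by step the finite-index normal subgroups avoiding given
    elements. At each step one excludes the next element of an enumeration of
    [G], which makes the total intersection trivial, and some nontrivial
    element of the current subgroup, which makes the chain strictly
    decreasing. *)
Lemma residual_chain : countable [set: G] -> infinite_set [set: G] ->
  residually_finite ->
  exists H : nat -> groupClosed G, [/\
    (forall g, g \in H 0%N),
    (forall n, normal_subgroup (H n) /\ finite_index (H n)),
    (forall n g, g \in H n.+1 -> g \in H n),
    (forall n, exists2 g, g \in H n & g \notin H n.+1) &
    (forall g, g <> 1 -> exists n, g \notin H n)].
Proof.
move=> cG iG rf.
have KP (w : G) : exists K : groupClosed G,
    [/\ normal_subgroup K, finite_index K & w <> 1 -> w \notin K].
  have [->|w1] := pselect (w = 1).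
    by exists groupT; split=> //; exact: finite_indexT.
  by have [K [nK fK wK]] := rf w w1; exists K.
have [K Kprop] := choice KP.
pose cap ws : groupClosed G := foldr (fun w L => groupI (K w) L) groupT ws.
have capP ws : normal_subgroup (cap ws) /\ finite_index (cap ws).
  elim: ws => [|w ws [nws fws]] /=; first by split=> //; exact: finite_indexT.
  have [nK fK _] := Kprop w.
  by split; [exact: normal_subgroupI | exact: finite_indexI].
have ntP (L : groupClosed G) : exists g, finite_index L -> g \in L /\ g <> 1.
  have [fL|] := pselect (finite_index L); last by exists 1.
  have [g [gL g1]] : exists g, g \in L /\ g <> 1.
    apply: contrapT => /forallNP L1; apply: iG.
    (* If [L] were trivial, its cosets would be as many as the elements of
       [G]. *)
    have cosetI : injective (fun g : G => [set k | g^-1 * k \in L]).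
      move=> g h gh; apply: contrapT => ngh; apply: (L1 (g^-1 * h)); split.
        have : [set k | h^-1 * k \in L] h by rewrite /= mulVg gpred1.
        by rewrite -gh.
      by move=> /(congr1 (fun k => g * k)); rewrite mulVKg mulg1 => /esym.
    by have := finite_preimage (in2W cosetI) fL; rewrite preimage_range.
  by exists g.
have [nt ntE] := choice ntP.
have [e eS] := countable_enumeration 1 cG.
pose fix ws n : seq G :=
  if n is m.+1 then e m :: nt (cap (ws m)) :: ws m else [::].
have wsE n g : (g \in cap (ws n.+1)) =
    [&& g \in K (e n), g \in K (nt (cap (ws n))) & g \in cap (ws n)] by [].
exists (fun n => cap (ws n)); split.
- by [].
- by move=> n; exact: capP.
- by move=> n g; rewrite wsE => /and3P[].
- move=> n; have [ntw nt1] := ntE _ (capP (ws n)).2.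
  exists (nt (cap (ws n))) => //; rewrite wsE.
  have [_ _ /(_ nt1) /negPf ->] := Kprop (nt (cap (ws n))).
  by rewrite andbF.
move=> g g1; have [n en] := eS g; exists n.+1.
rewrite wsE en.
by have [_ _ /(_ g1) /negPf ->] := Kprop g.
Qed.

End FiniteIndex.

Section FreeGroupResiduallyFinite.
Local Open Scope classical_set_scope.
Local Open Scope group_scope.

Lemma extend_partial_injection (T : finType) (D : {set T}) (rho : T -> T) :
  {in D &, injective rho} -> exists s : {perm T}, {in D, s =1 rho}.
Proof.
move=> rI.
pose R := [set rho y | y in D]%SET.
have cR : size (enum (~: R)%SET) = size (enum (~: D)%SET).
  by rewrite -!cardE [LHS]cardsCs [RHS]cardsCs !finset.setCK /R card_in_imset.
pose f x := if x \in D then rho x else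
  nth x (enum (~: R)%SET) (index x (enum (~: D)%SET)).
have fR x : (f x \in R) = (x \in D).
  rewrite /f; case: ifP => xD; first exact: finset.imset_f.
  apply/negbTE; rewrite -finset.in_setC -mem_enum mem_nth//.
  by rewrite cR index_mem mem_enum finset.in_setC xD.
have fI : injective f.
  move=> x y fxy; have := fR x; rewrite fxy fR; move: fxy; rewrite /f.
  case: ifP => xD; case: ifP => yD // fxy _; first exact: rI.
  have ix z : z \notin D ->
      (index z (enum (~: D)%SET) < size (enum (~: R)%SET))%N.
    by move=> zD; rewrite cR index_mem mem_enum finset.in_setC.
  move: fxy; rewrite (set_nth_default y) ?ix ?xD// => /eqP.
  rewrite nth_uniq ?enum_uniq ?ix ?xD ?yD// => /eqP.
  move=> e; apply: (index_inj x _ _ e).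
    by rewrite mem_enum finset.in_setC xD.
  by rewrite mem_enum finset.in_setC yD.
by exists (perm fI) => x xD; rewrite permE /f xD.
Qed.

(** A nontrivial [w] acts nontrivially on the finite set of its own suffixes:
    left multiplication by a generator is a partial injection of that set,
    extend it to a permutation; letter by letter, [w] then carries the empty
    suffix to [w] itself without leaving the set. *)
Lemma free_group_residually_finite (B : choiceType) :
  residually_finite (free_group B).
Proof.
apply: residually_finite_of_actions => w w1.
pose suf : seq (free_group B) :=
  [seq fg_mk (drop i (val w)) | i <- iota 0 (size (val w)).+1].
have sufP i : (i <= size (val w))%N -> fg_mk (drop i (val w)) \in suf.
  by move=> iw; apply/mapP; exists i; rewrite // mem_iota.
pose A := seq_sub suf.
have sgP (b : B) : exists s : {perm A}, forall u : A,
    forall v : A, val v = generator b * val u -> s u = v.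
  pose rho (u : A) : A := insubd u (generator b * val u).
  have [|s sE] := @extend_partial_injection A
      [set u : A | generator b * val u \in suf]%SET rho.
    move=> u v; rewrite !finset.in_set => uD vD /(congr1 val).
    by rewrite !val_insubd uD vD => /mulgI/val_inj.
  exists s => u v vE; rewrite sE; last by rewrite finset.in_set -vE (valP v).
  by apply: val_inj; rewrite val_insubd -vE (valP v).
have [sigma sigmaE] := choice sgP.
exists A, (free_act sigma); split; [exact: free_act1 | exact: free_actM |].
have s1 : (1 : free_group B) \in suf.
  by have := sufP _ (leqnn _); rewrite drop_size fg_mk_nil.
exists (SeqSub s1) => /(congr1 val) /=; rewrite -[RHS]/(1 : free_group B) => wy.
apply: w1; rewrite -{}wy.
have IH i : (i <= size (val w))%N -> forall y : A,
    y = word_act sigma (drop (size (val w) - i) (val w)) (SeqSub s1) ->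
    val y = fg_mk (drop (size (val w) - i) (val w)).
  elim: i => [_ y|i IH iw y].
    by rewrite subn0 drop_size => ->; exact: val_inj.
  set j := (size (val w) - i.+1)%N.
  have jw : (j < size (val w))%N by rewrite /j ltn_subrL; case: (size _) iw.
  have ji : (size (val w) - i)%N = j.+1 by rewrite /j subnSK.
  case Ew : (val w) (jw) => [//|l0 w0] _; rewrite -Ew => yE.
  have := IH (ltnW iw) _ erefl; rewrite ji; set z := word_act _ _ _ => zE.
  pose v : A := SeqSub (sufP j (ltnW jw)).
  suff -> : y = v by [].
  rewrite yE (drop_nth l0 jw) /= -/z.
  have vE : val v = fg_mk [:: nth l0 (val w) j] * val z.
    by rewrite zE [LHS]/= (drop_nth l0 jw) -cat1s fg_mk_cat.
  case: (nth l0 (val w) j) vE => b [] vE; last exact: sigmaE.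
  rewrite /letter_act /=; apply: (canLR (permK _)); apply/esym/sigmaE.
  by rewrite vE fg_mk_inverse_letter mulVKg.
have := IH _ (leqnn _) _ erefl; rewrite subnn drop0 fg_mk_val => wE.
exact: esym wE.
Qed.
End FreeGroupResiduallyFinite.

(** * The topology of a subshift *)

Section SubshiftTopology.
Local Open Scope classical_set_scope.
Local Open Scope group_scope.
Variables (G : groupType) (S : finType).
Local Notation FS := (full_shift G S).

Lemma near_cylinder (W : seq G) (x : FS) : \forall y \near x, {in W, y =1 x}.
Proof.
elim: W => [|h W IH].
  by apply: (@nearW _ (nbhs x)) => y h; rewrite in_nil.
have hx : \forall y \near x, y h = x h.
  have xh : nbhs (x h : discrete_topology S) [set s | s = x h].
    exact: discrete_set1.
  exact: (@proj_continuous G (fun=> discrete_topology S) h x _ xh).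
apply: filterS2 hx IH => y yh yW k; rewrite inE => /orP[/eqP ->//|].
exact: yW.
Qed.

(** Sets of points that agree with [x] on a finite window form a filter that
    converges to [x] in each coordinate, hence in the product topology. *)
Lemma nbhs_cylinder (x : FS) (U : set FS) : nbhs x U ->
  exists W : seq G, forall y, {in W, y =1 x} -> U y.
Proof.
pose F : set_system FS := fun V => exists W : seq G,
  forall y, {in W, y =1 x} -> V y.
have FF : Filter F.
  split; first by exists [::].
    move=> A B [V VA] [W WB]; exists (V ++ W) => y yVW; split.
      by apply: VA => h hV; apply: yVW; rewrite mem_cat hV.
    by apply: WB => h hW; apply: yVW; rewrite mem_cat hW orbT.
  by move=> A B AB [W WA]; exists W => y /WA /AB.
suff : F --> x by exact.
apply/cvg_sup => h U0 [_ [[V oV <-] Vx] VU0].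
by exists [:: h] => y yx; apply: VU0; rewrite /= yx ?inE.
Qed.

Lemma full_shift_compact : compact [set: FS].
Proof.
have cS : compact [set: discrete_topology S].
  by apply: finite_compact; exact: finite_finset.
have := @tychonoff G (fun=> discrete_topology S) (fun=> setT) (fun=> cS).
by congr (compact _); apply/seteqP; split.
Qed.

Variable x : FS.
Local Notation O := (orbit_closure (@Defs.shift G S) x).

Lemma val_continuous : continuous (val : O -> FS).
Proof. exact: (@initial_continuous O FS (@set_val _ O)). Qed.

Lemma near_sub_cylinder (W : seq G) (y : O) :
  \forall z \near y, {in W, (val z : FS) =1 (val y : FS)}.
Proof. exact: (val_continuous (near_cylinder W (val y))). Qed.

Lemma nbhs_sub_cylinder (y : O) (U : set O) : nbhs y U ->
  exists W : seq G, forall z : O, {in W, (val z : FS) =1 (val y : FS)} -> U z.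
Proof.
move=> [_ [[V oV <-] Vy] VU].
have [|W WV] := @nbhs_cylinder (val y) V; first exact: open_nbhs_nbhs.
by exists W => z /WV Vz; exact: VU.
Qed.

Lemma subshift_pattern (y : O) (W : seq G) :
  exists k : G, {in W, forall h, (val y : FS) h = x (k * h)}.
Proof.
have := set_mem (valP y); move=> /(_ _ (near_cylinder W (val y))).
move=> [_ [[k _ <-] yk]]; exists k^-1 => h hW.
by rewrite -yk.
Qed.

Lemma orbit_in_closure (k : G) :
  (@orbit_closure G FS (@Defs.shift G S) x) (Defs.shift S k x).
Proof.
have Ok : Defs.orbit (@Defs.shift G S) x (Defs.shift S k x) by exists k.
exact: (@subset_closure FS _ _ Ok).
Qed.

Definition orbit_point (k : G) : O := SigSub (mem_set (@orbit_in_closure k)).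

Lemma orbit_pointE k h : (val (orbit_point k) : FS) h = x (k^-1 * h).
Proof. by []. Qed.

Lemma subshiftE g (y : O) h :
  (val (subshift x g y) : FS) h = (val y : FS) (g^-1 * h).
Proof. by []. Qed.

Lemma subshift_compact : compact [set: O].
Proof.
move=> F PF FO.
have cO : compact (@orbit_closure G FS (@Defs.shift G S) x).
  apply: (subclosed_compact _ full_shift_compact) => //.
  exact: closed_closure.
have [|p [pO pF]] := cO ((val : O -> FS) @ F) _.
  by rewrite /nbhs /=; apply: filterS FO => z _; exact: set_mem (valP z).
exists (SigSub (mem_set pO)); split => // A B FA [_ [[V oV <-] Vp] VB].
have VF : nbhs p V by exact: open_nbhs_nbhs.
have AF : F ((val : O -> FS) @^-1` ((val : O -> FS) @` A)).
  by apply: filterS FA => z Az; exists z.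
have [_ [[z Az <-] Vz]] := pF _ _ AF VF.
by exists z; split => //; exact: VB.
Qed.

Lemma subshift_zero_dimensional : zero_dimensional O.
Proof.
move=> y z /eqP yz.
have [h hyz] : exists h, (val y : FS) h <> (val z : FS) h.
  apply: contrapT => /forallNP yz'; apply: yz; apply: val_inj.
  by apply/funext => h; apply: contrapT; exact: yz'.
have lc : locally_constant (fun u : O => (val u : FS) h).
  move=> u; apply: filterS (near_sub_cylinder [:: h] u) => v; apply.
  by rewrite inE.
exists [set u | (val u : FS) h = (val y : FS) h]; split => //; last exact/nesym.
split; first exact: (locally_constant_open_preimage [set (val y : FS) h] lc).
rewrite -[X in closed X]setCK; apply: open_closedC.
exact: (locally_constant_open_preimage (~` [set (val y : FS) h]) lc).
Qed.

(** On a compact space, the windows that decide [lab] locally can be merged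
    into one. *)
Lemma locally_constant_window (L : Type) (lab : O -> L) :
  locally_constant lab -> exists W : seq G, forall y z : O,
    {in W, (val y : FS) =1 (val z : FS)} -> lab y = lab z.
Proof.
move=> labc.
pose P (W : seq G) (y : O) := forall z : O,
  {in W, (val z : FS) =1 (val y : FS)} -> lab z = lab y.
have [y|s sP] := compact_finite_witnesses (P := P) subshift_compact.
  have [W WP] := nbhs_sub_cylinder (labc y); exists W.
  apply: filterS (near_sub_cylinder W y) => z zy u uz.
  rewrite (WP z)//; apply: WP => h hW; by rewrite uz// zy.
exists (flatten s) => y z yz; have [W Ws WP] := sP z.
by apply: WP => h hW; apply: yz; apply/flattenP; exists W.
Qed.

End SubshiftTopology.

(** * Toeplitz points have minimal orbit closures *)

Section Minimality.
Local Open Scope classical_set_scope.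
Local Open Scope group_scope.

Lemma finite_intersection (G : groupType) (I : eqType) (s : seq I)
    (P : I -> groupClosed G -> Prop) :
  (forall i (H K : groupClosed G), {subset H <= K} -> P i K -> P i H) ->
  (forall i, i \in s -> exists2 H : groupClosed G, finite_index H & P i H) ->
  exists2 H : groupClosed G, finite_index H & forall i, i \in s -> P i H.
Proof.
move=> mono; elim: s => [|i s IH] Ps.
  by exists (groupT G) => //; exact: finite_indexT.
have [j js|H fH HP] := IH; first by apply: Ps; rewrite inE js orbT.
have [K fK KP] := Ps i (mem_head _ _).
exists (groupI H K); first exact: finite_indexI.
move=> j; rewrite inE => /orP[/eqP ->|js].
  by apply: mono KP => g; rewrite in_groupI => /andP[].
by apply: mono (HP j js) => g; rewrite in_groupI => /andP[].
Qed.

(** The translates of [x] by a finite-index subgroup [H] all show the pattern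
    of [x] on a given finite window, so each orbit in the closure of that of
    [x] meets this pattern within a finite set of coset representatives of
    [H]. *)
Lemma toeplitz_minimal (G : groupType) (S : finType) (x : full_shift G S) :
  toeplitz x -> minimal (subshift x).
Proof.
move=> tx y U [z Uz] oU.
have [|W WU] := @nbhs_sub_cylinder _ _ x z U; first exact: open_nbhs_nbhs.
have [k zk] := subshift_pattern z W.
(* z agrees on W with the k^-1-translate of x; W' = k W *)
pose W' := [seq k * h | h <- W].
have [h H K HK KP c cH|h _|H fH HP] := @finite_intersection G G W'
    (fun h H => forall c : G, c \in H -> x (c * h) = x h).
- by apply: KP; exact: HK.
- exact: tx.
have [s sP] := finite_index_reps fH.
(* y agrees with the l^-1-translate of x on all r W' *)
have [l yl] := subshift_pattern y [seq r * h | r <- s, h <- W'].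
have [r rs rl] := sP l^-1.
exists (subshift x (k^-1 * r^-1) y); split; last by exists (k^-1 * r^-1).
apply: WU => h hW; rewrite subshiftE zk// invgM !invgK -mulgA.
rewrite yl; last by apply: allpairs_f => //; exact: map_f.
have lrH : l * r \in H by rewrite -gpredV invgM.
have khW : k * h \in W' by exact: map_f.
by rewrite (mulgA l); exact: HP khW _ lrH.
Qed.

End Minimality.

(** * A free Toeplitz subshift with finite models *)

Section Toeplitz.
Local Open Scope classical_set_scope.
Local Open Scope group_scope.
Variables (G : groupType) (H : nat -> groupClosed G) (t : nat -> G).
Hypothesis H0 : forall g, g \in H 0%N.
Hypothesis Hnorm : forall n, normal_subgroup (H n).
Hypothesis Hfin : forall n, finite_index (H n).
Hypothesis Hdec : forall n g, g \in H n.+1 -> g \in H n.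
Hypothesis Hstrict : forall n, exists2 g, g \in H n & g \notin H n.+1.
Hypothesis Hcap : forall g, g <> 1 -> exists n, g \notin H n.

(** The cosets [H_n t_n] decrease to the empty set; the point built below is
    [H_n]-periodic off [H_n t_n], so [hole n] is what remains undetermined at
    stage [n]. *)
Definition hole n : {pred G} := fun g => g * (t n)^-1 \in H n.
Hypothesis tdec : forall n, t n.+1 \in hole n.
Hypothesis tcap : forall g, exists n, g \notin hole n.

Lemma in_hole n g : (g \in hole n) = (g * (t n)^-1 \in H n).
Proof. by []. Qed.

Lemma hole_mull n g h : g \in H n -> (g * h \in hole n) = (h \in hole n).
Proof. by move=> gH; rewrite !in_hole -mulgA [LHS]gpredMl. Qed.

Lemma hole_diff n g h : g \in hole n -> (h \in hole n) = (h * g^-1 \in H n).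
Proof.
move=> gn; rewrite in_hole.
have -> : h * (t n)^-1 = (h * g^-1) * (g * (t n)^-1) by rewrite !mulgA mulgVK.
by rewrite [LHS]gpredMr.
Qed.

Lemma chain_le m n g : (m <= n)%N -> g \in H n -> g \in H m.
Proof.
elim: n => [|n IH]; first by rewrite leqn0 => /eqP ->.
by rewrite leq_eqVlt => /orP[/eqP ->//|/IH {}IH /Hdec].
Qed.

Lemma hole_dec n g : g \in hole n.+1 -> g \in hole n.
Proof.
move=> gn1; have gn := Hdec (gn1 : g * (t n.+1)^-1 \in H n.+1).
by rewrite -(mulgVK (t n.+1) g) hole_mull.
Qed.

Lemma hole_le m n g : (m <= n)%N -> g \in hole n -> g \in hole m.
Proof.
elim: n => [|n IH]; first by rewrite leqn0 => /eqP ->.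
by rewrite leq_eqVlt => /orP[/eqP ->//|/IH {}IH /hole_dec].
Qed.

Definition level (g : G) : nat := ex_minn (tcap g).

Lemma level_gt n g : (n < level g)%N = (g \in hole n).
Proof.
rewrite /level; case: ex_minnP => m gm mmin.
apply/idP/idP => [nm|gn].
  by apply: contraLR nm => /mmin; rewrite -leqNgt.
by rewrite ltnNge; apply: contra gm => mn; exact: hole_le gn.
Qed.

Lemma levelP n g : g \in hole n -> g \notin hole n.+1 -> level g = n.+1.
Proof.
rewrite -!level_gt -leqNgt => gn gn1.
by apply/eqP; rewrite eqn_leq gn gn1.
Qed.

Lemma level_mull n g h :
  g \in H n -> h \notin hole n -> level (g * h) = level h.
Proof.
move=> gH hn; have agree m : (m <= n)%N -> (g * h \in hole m) = (h \in hole m).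
  by move=> mn; rewrite hole_mull// (chain_le mn).
have lhn : (level h <= n)%N by rewrite leqNgt level_gt.
case: (ltngtP (level (g * h)) (level h)) => // lt; exfalso; move: (lt).
  rewrite level_gt -agree; last exact: leq_trans (ltnW lt) lhn.
  by rewrite -level_gt ltnn.
by rewrite level_gt agree// -level_gt ltnn.
Qed.

(** The points of [hole n] that are not in [hole n.+1] all get the same
    symbol, alternately 0 and 1. For the integers and the subgroups of index
    [2^n] this is a period-doubling sequence. *)
Definition toeplitz_point : full_shift G bool := fun g => odd (level g).
Local Notation x := toeplitz_point.

Lemma toeplitz_pointP : toeplitz x.
Proof.
move=> h; have [n hn] := tcap h; exists (H n) => // k kH.
by rewrite /toeplitz_point (level_mull kH hn).
Qed.

Lemma hole_strict n : exists2 g, g \in hole n & g \notin hole n.+1.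
Proof.
have [g gn gn1] := Hstrict n; exists (g * t n.+1).
  by rewrite hole_mull.
by rewrite in_hole mulgK.
Qed.

(** Let [g] be nontrivial, in [H_m] but not in [H_(m+1)]. Near any position
    the point shows, within a window of coset representatives of [H_(m+2)], an
    element of level [m + 2]; multiplied by a conjugate of [g^-1], this
    element leaves the hole of stage [m + 1] but not that of stage [m], so
    gets level [m + 1]. The symbols at the two places differ, in every point
    of the orbit closure, and [g] has no fixed point. *)
Lemma toeplitz_free : free_action (subshift x).
Proof.
move=> g y gy; apply: contrapT => g1.
have [m gm gm1] : exists2 m, g \in H m & g \notin H m.+1.
  have ex := Hcap g1; have := ex_minnP ex.
  case=> [[|m] gm mmin]; first by rewrite H0 in gm.
  exists m => //; apply: contraT => /mmin; by rewrite ltnn.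
have [z zm1 zm2] := hole_strict m.+1.
have [s sP] := finite_index_reps (Hfin m.+2).
have [k yk] := subshift_pattern y (s ++ [seq g^-1 * r | r <- s]).
have [r rs rz] := sP (k^-1 * z).
have krz : k * r * z^-1 \in H m.+2.
  have := Hnorm (k * r) rz; rewrite (mulgA r^-1) -invgM mulVKg.
  by rewrite -gpredV invgM invgK.
have yr :
    (val y : full_shift G bool) (g^-1 * r) = (val y : full_shift G bool) r.
  by rewrite -[in RHS]gy.
have lkr : level (k * r) = m.+2.
  apply: levelP; rewrite -(mulgVK z (k * r)) hole_mull//.
  exact: Hdec.
have lgr : level (k * (g^-1 * r)) = m.+1.
  have -> : k * (g^-1 * r) = (k * g^-1 * k^-1) * (k * r).
    by rewrite !mulgA mulgVK.
  have krm : k * r \in hole m.+1 by rewrite -level_gt lkr.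
  apply: levelP.
    rewrite hole_mull; first exact: hole_dec.
    by apply: Hnorm; rewrite gpredV.
  rewrite (hole_diff _ krm) mulgK; apply: contra gm1 => /(Hnorm k^-1).
  by rewrite invgK !mulgA mulVg mul1g mulgVK gpredV.
move: yr; rewrite !yk; [|by rewrite mem_cat rs|by rewrite mem_cat map_f ?orbT].
by rewrite /toeplitz_point lkr lgr /= => /esym; case: odd.
Qed.

(** A periodic approximation: the hole of stage [n] is filled with the symbol
    that [x] takes on [hole n] minus [hole n.+1]. *)
Definition periodic_point n : full_shift G bool :=
  fun g => if g \in hole n then odd n.+1 else x g.

Lemma periodic_pointP n g h : g \in H n ->
  periodic_point n (g * h) = periodic_point n h.
Proof.
move=> gH; rewrite /periodic_point hole_mull//; case: ifPn => // hn.
by rewrite /toeplitz_point (level_mull gH hn).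
Qed.

Lemma shift_periodic n (g h : G) : g^-1 * h \in H n ->
  Defs.shift bool g (periodic_point n) = Defs.shift bool h (periodic_point n).
Proof.
move=> gh; apply/funext => k /=; rewrite /shift_map.
have -> : g^-1 * k = (g^-1 * h) * (h^-1 * k) by rewrite mulgA mulgK.
by rewrite periodic_pointP.
Qed.

(** For a large stage the elements of a finite window lie in different cosets,
    so at most one of them falls into the hole. *)
Lemma small_window (W : seq G) : exists n, forall m, (n <= m)%N ->
  {in W &, forall g h, g * h^-1 \in H m -> g = h}.
Proof.
have sep (g h : G) : exists n,
    forall m, (n <= m)%N -> g * h^-1 \in H m -> g = h.
  have [->|gh] := pselect (g = h); first by exists 0%N.
  have [|n gn] := Hcap (g := g * h^-1).
    by move=> /(congr1 (fun k => k * h)); rewrite mulgVK mul1g.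
  by exists n => m nm /(chain_le nm); rewrite (negPf gn).
have [N NP] := choice (fun gh : G * G => sep gh.1 gh.2).
exists (\max_(gh <- [seq (g, h) | g <- W, h <- W]) N gh) => m mN g h gW hW.
apply: (NP (g, h)); apply: leq_trans mN.
by apply: (@leq_bigmax_seq _ _ _ N) => //; exact: allpairs_f.
Qed.

Lemma avoid_hole (s : seq G) : exists n, forall m, (n <= m)%N ->
  {in s, forall g, g \notin hole m}.
Proof.
exists (\max_(g <- s) level g) => m sm g gs.
rewrite -level_gt -leqNgt; apply: leq_trans sm.
by apply: (@leq_bigmax_seq _ _ _ level).
Qed.

(** If a pattern of the periodic point meets the hole, it does so at one place
    only; an element of [H_n] then moves this place to one where [x] itself
    takes the filling symbol, without affecting the rest of the pattern. *)
Lemma periodic_pattern n (W : seq G) (k : G) :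
  {in W &, forall g h, g * h^-1 \in H n -> g = h} ->
  exists c : G, {in W, forall h, x (c * h) = periodic_point n (k * h)}.
Proof.
move=> Wn.
have [[h hW hk]|noh] := pselect (exists2 h, h \in W & k * h \in hole n).
  have [z zn zn1] := hole_strict n.
  pose c := z * (k * h)^-1 ; have cH : c \in H n by rewrite -hole_diff.
  exists (c * k) => h' h'W; rewrite -mulgA /periodic_point.
  case: ifPn => h'n; last by rewrite /toeplitz_point (level_mull cH h'n).
  have -> : h' = h.
    apply: Wn => //; move: h'n; rewrite (hole_diff _ hk) => /(Hnorm k^-1).
    by rewrite invgM !mulgA mulVg mul1g invgK mulgVK.
  by rewrite /c mulgVK /toeplitz_point (levelP zn zn1).
exists k => h hW; rewrite /periodic_point ifF//.
by apply/negP => hk; apply: noh; exists h.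
Qed.

(** The finite orbit of a periodic approximation is a finite model: its
    patterns all occur in [x] by [periodic_pattern], and conversely the
    finitely many patterns of [x] on the window appear at places that the hole
    of a late stage avoids. *)
Lemma toeplitz_finitely_modelled : finitely_modelled (subshift x).
Proof.
move=> E L lab labc; have [W WP] := locally_constant_window labc.
have [pts ptsP] :=
  locally_constant_finite_range (@subshift_compact G bool x) labc.
have [loc locP] := choice
  (fun y : orbit_closure (@Defs.shift G bool) x => subshift_pattern y W).
pose W' := flatten [seq [seq g^-1 * h | h <- W] | g <- 1 :: E].
have W'P g h : g \in 1 :: E -> h \in W -> g^-1 * h \in W'.
  by move=> gE hW; apply/flatten_mapP; exists g => //; exact: map_f.
have [n1 n1P] := small_window W'.
have [n2 n2P] := avoid_hole [seq loc p * h | p <- pts, h <- W].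
pose n := maxn n1 n2.
have {}n1P := n1P n (leq_maxl _ _); have {}n2P := n2P n (leq_maxr _ _).
pose px := periodic_point n.
have finO : finite_set (range (fun k => Defs.shift bool k px)).
  have [s sP] := finite_index_reps (Hfin n).
  apply: (@sub_finite_set _ _
    [set` [seq Defs.shift bool k px : full_shift G bool | k <- s]]).
    move=> _ [k _ <-]; have [r rs rk] := sP k.
    have <- : Defs.shift bool r px = Defs.shift bool k px := shift_periodic rk.
    exact: (map_f (fun k => Defs.shift bool k px : full_shift G bool)).
  exact: finite_seq.
pose A := fset_set (range (fun k => Defs.shift bool k px)).
have inA y : (y \in A) <-> exists k, y = Defs.shift bool k px.
  rewrite in_fset_set// inE; split=> [[k _ <-]|[k ->]]; first by exists k.
  by exists k.
have actP (g : G) (y : A) : Defs.shift bool g (val y) \in A.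
  have /inA[k ->] := valP y; apply/inA; exists (g * k).
  by rewrite (actionM (@Defs.shift G bool)).
pose act (g : G) (y : A) : A := [` actP g y]%fset.
have ptP (y : A) : exists p : orbit_closure (@Defs.shift G bool) x,
    {in W', (val p : full_shift G bool) =1 (val y : full_shift G bool)}.
  have /inA[k ->] := valP y.
  have [c cP] := periodic_pattern k^-1 n1P.
  by exists (orbit_point x c^-1) => h hW; rewrite orbit_pointE invgK cP.
have [pt ptE] := choice ptP.
exists A, act, pt; split.
- by move=> y; apply: val_inj => /=; exact: (action1 (@Defs.shift G bool)).
- by move=> g h y; apply: val_inj => /=; exact: (actionM (@Defs.shift G bool)).
- move=> g gE y; apply: WP => h hW.
  rewrite ptE; last by rewrite -[h]mul1g -invg1 W'P ?inE ?eqxx.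
  rewrite subshiftE ptE//; last by rewrite W'P// inE gE orbT.
- move=> z; have [p pp ->] := ptsP z.
  have yA : Defs.shift bool (loc p)^-1 px \in A by apply/inA; exists (loc p)^-1.
  exists [` yA]%fset; apply: WP => h hW.
  rewrite ptE; last by rewrite -[h]mul1g -invg1 W'P ?inE ?eqxx.
  rewrite locP//= /shift_map invgK /px /periodic_point ifF//.
  by apply/negbTE/n2P; exact: allpairs_f.
Qed.

End Toeplitz.

(** * Countability and soficity *)

Section Assembly.
Local Open Scope classical_set_scope.
Local Open Scope group_scope.

(** It remains to choose the cosets [H_n t_n] with empty intersection: as
    [H_n] strictly contains [H_(n+1)], the coset [H_n t_n] contains at least
    two cosets of [H_(n+1)], one of which avoids the [n]-th element of [G]. *)
Lemma toeplitz_model_exists (G : groupType) :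
  countable [set: G] -> infinite_set [set: G] -> residually_finite G ->
  exists x : full_shift G bool, [/\ toeplitz x, minimal (subshift x),
    free_action (subshift x) & finitely_modelled (subshift x)].
Proof.
move=> cG iG rf.
have [H [H0 HP Hdec Hstrict Hcap]] := residual_chain cG iG rf.
have Hnorm n : normal_subgroup (H n) by case: (HP n).
have Hfin n : finite_index (H n) by case: (HP n).
have [e eS] := countable_enumeration 1 cG.
have [h hP] := choice (fun n => let: ex_intro2 g gn gn1 := Hstrict n in
  ex_intro (fun g => g \in H n /\ g \notin H n.+1) g (conj gn gn1)).
pose fix t n : G := if n is m.+1 then
  (if e m * (t m)^-1 \in H m.+1 then h m * t m else t m) else 1.
have tE n : t n.+1 = if e n * (t n)^-1 \in H n.+1 then h n * t n else t n by [].
have tdec n : t n.+1 \in hole H t n.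
  rewrite in_hole tE; case: ifP => _; last by rewrite mulgV gpred1.
  by rewrite mulgK; case: (hP n).
have tcap g : exists n, g \notin hole H t n.
  have [n <-] := eS g; exists n.+1; rewrite in_hole tE.
  case: ifPn => // en; rewrite invgM mulgA.
  apply/negP => enh; have [_ /negP] := hP n; apply.
  by rewrite -gpredV -(mulKg (e n * (t n)^-1) (h n)^-1) gpredM// gpredV.
exists (toeplitz_point tcap); split.
- exact: toeplitz_pointP.
- by apply: toeplitz_minimal; exact: toeplitz_pointP.
- exact: toeplitz_free.
- exact: toeplitz_finitely_modelled.
Qed.

(** An element of the full group is determined by a finite list of rules of
    the form: apply [g] to the points that show such pattern on such finite
    window. *)
Lemma subshift_full_group_countable (G : groupType) (S : finType)
    (x : full_shift G S) : countable [set: G] ->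
  countable [set: topological_full_group (subshift x)].
Proof.
move=> /countable_injP[iota iotaI].
have {}iotaI : injective iota by move=> g h; apply: iotaI; rewrite inE.
pose O := orbit_closure (@Defs.shift G S) x.
pose matches (pat : seq (G * S)) (y : O) :=
  all (fun hs => (val y : full_shift G S) hs.1 == hs.2 :> S) pat.
pose codes (d : seq (seq (G * S) * G))
    (f : topological_full_group (subshift x)) :=
  (forall y : O, exists2 pg, pg \in d & matches pg.1 y) /\
  (forall pg, pg \in d -> forall y, matches pg.1 y ->
     val f y = subshift x pg.2 y).
have codeP f : exists d, codes d f.
  have [c [cc fc]] := full_group_cocycle f.
  have [W WP] := locally_constant_window cc.
  pose pat (y : O) : seq (G * S) :=
    [seq (h, (val y : full_shift G S) h) | h <- W].
  have matchP y z : matches (pat y) z <->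
      {in W, (val z : full_shift G S) =1 (val y : full_shift G S)}.
    rewrite /matches all_map; split=> [/allP yz h hW|yz].
      by apply/eqP; exact: yz.
    by apply/allP => h hW; apply/eqP; exact: yz.
  have patc : locally_constant pat.
    move=> y; apply: filterS (near_sub_cylinder W y) => z zy.
    by apply/eq_in_map => h hW; rewrite zy.
  have [pts ptsP] :=
    locally_constant_finite_range (@subshift_compact G S x) patc.
  exists [seq (pat p, c p) | p <- pts]; split.
    move=> y; have [p pp yp] := ptsP y; exists (pat p, c p); first exact: map_f.
    by rewrite /= -yp; apply/matchP.
  move=> _ /mapP[p pp ->] y /matchP yp; rewrite fc /=.
  by rewrite (WP y p yp).
have [code codeE] := choice codeP.
have codeI : injective code.
  move=> f g fg; apply: val_inj; apply: homeo_ext => y.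
  have [fcov fval] := codeE f; have [_ gval] := codeE g.
  have [pg pgd my] := fcov y.
  by rewrite (fval pg pgd y my) (gval pg _ y my)// -fg.
pose tonat (pg : seq (G * S) * G) : seq (nat * S) * nat :=
  ([seq (iota hs.1, hs.2) | hs <- pg.1], iota pg.2).
have tonatI : injective tonat.
  move=> [p g] [q h] [pq /iotaI ->]; congr (_, _); apply: inj_map pq.
  by move=> [a s] [b s'] [/iotaI -> ->].
apply/countable_injP; exists (fun f => choice.pickle (map tonat (code f))).
by move=> f g _ _ /(pcan_inj choice.pickleK)/(inj_map tonatI)/codeI.
Qed.

(** The left regular representation of the approximating finite group moves
    every point for a nontrivial element, so all Hamming distances are exactly
    0 or 1. *)
Lemma LEF_sofic (R : realType) (G : groupType) :
  countable [set: G] -> LEF G -> sofic R G.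
Proof.
move=> cG lef; split=> // F eps eps0.
have [K [op [FK [opA [e [inv [op1 ope opVl opVr]]]] opM]]] := lef (1 |` F)%fset.
have inF g : g \in F -> g \in (1 |` F)%fset by move=> gF; rewrite !inE gF orbT.
have in1 : 1 \in (1 |` F)%fset by rewrite !inE eqxx.
have inK g : g \in (1 |` F)%fset -> g \in K by exact: (fsubsetP FK).
pose k1 : K := [` inK _ in1]%fset.
(* The unit of [G] is idempotent for [op], hence is the unit of the finite
   group. *)
have k1E : k1 = e.
  have k11 : op k1 k1 = k1 by apply: val_inj; rewrite opM//= mulg1.
  by rewrite -[LHS]op1 -(opVl k1) -opA k11.
pose Theta (g : G) (k : K) : K := if insub g is Some k' then op k' k else k.
have ThetaE g (gK : g \in K) k : Theta g k = op [` gK]%fset k.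
  by rewrite /Theta insubT.
exists K, Theta; split.
- by apply/card_gt0P; exists k1.
- by apply/funext => k; rewrite (ThetaE _ (inK _ in1)) -/k1 k1E op1.
- move=> f g fF gF fgF.
  have -> : hamming R (Theta (f * g)) (Theta f \o Theta g) = 0%R.
    rewrite /hamming (_ : [set _ | _]%SET = finset.set0) ?cards0 ?mul0r//.
    apply/setP => k; rewrite !inE; apply/negbTE; rewrite negbK.
    rewrite /= !(ThetaE _ (inK _ (inF _ fF)), ThetaE _ (inK _ (inF _ gF)),
      ThetaE _ (inK _ (inF _ fgF))).
    rewrite opA; apply/eqP; congr op; apply: val_inj.
    by rewrite opM ?inF.
  exact: ltW.
- move=> f fF f1.
  have -> : hamming R (Theta f) id = 1%R.
    rewrite /hamming (_ : [set _ | _]%SET = finset.setT).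
      by rewrite cardsT divff// pnatr_eq0 -lt0n; apply/card_gt0P; exists k1.
    apply/setP => k; rewrite !inE (ThetaE _ (inK _ (inF _ fF))).
    apply/eqP => fk; apply: f1.
    have : op [` inK _ (inF _ fF)]%fset k1 = k1.
      by rewrite k1E -[in LHS](opVr k) opA fk /= opVr.
    by move=> /(congr1 val); rewrite opM//= ?inF// mulg1.
  by rewrite ltrBlDr ltrDl.
Qed.

Lemma free_group_countable (r : option nat) :
  countable [set: free_group_of_rank r].
Proof.
have [iota iotaI] : exists iota : generators r -> nat, injective iota.
  by case: r => [n|] /=; [exists val; exact: val_inj | exists id].
pose tonat (l : letter (generators r)) : nat * bool := (iota l.1, l.2).
have tonatI : injective tonat by move=> [a c] [b d] [/iotaI -> ->].
apply/countable_injP.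
exists (fun g : free_group (generators r) => choice.pickle (map tonat (val g))).
by move=> f g _ _ /(pcan_inj choice.pickleK)/(inj_map tonatI)/val_inj.
Qed.

Lemma free_group_infinite (B : choiceType) (b : B) :
  infinite_set [set: free_group B].
Proof.
have pow n : reduced (nseq n (b, false)).
  elim: n => [|[|n] IH] //; rewrite /reduced /= in IH *.
  by rewrite IH andbT xpair_eqE andbF.
pose f n : free_group B := exist _ (nseq n (b, false)) (pow n).
have fI : injective f.
  by move=> m n /(congr1 (fun g : free_group B => size (val g)));
    rewrite !size_nseq.
move=> /(finite_preimage (in2W fI)); rewrite preimage_setT; exact: infinite_nat.
Qed.

End Assembly.

Theorem corollary1p3 (R : realType) (r : option nat) (r_pos : r <> Some 0%N) :
  (forall (X : ptopologicalType) (alpha : action (free_group_of_rank r) X),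
     homeomorphic X cantor_space ->
     minimal alpha ->
     topologically_free alpha ->
     (exists mu : probability (borel X) R, invariant_probability alpha mu) ->
     LEF (topological_full_group alpha))
  /\
  (exists (S : finType) (x : full_shift (free_group_of_rank r) S),
     [/\ toeplitz x,
         minimal (subshift x),
         free_action (subshift x),
         LEF (topological_full_group (subshift x))
       & sofic R (topological_full_group (subshift x))]).
Proof.
split.
  move=> X alpha /homeomorphic_cantor[cX zX] mX tX [mu imu].
  exact: (LEF_of_invariant_measure cX zX mX tX imu).
have b : generators r.
  by case: r r_pos => [[|n]|] //= _; [exact: ord0|exact: 0%N].
have cF := free_group_countable r.
have [x [tx mx fx fmx]] := toeplitz_model_exists cF
  (free_group_infinite b) (@free_group_residually_finite (generators r)).
have lefx : LEF (topological_full_group (subshift x)).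
  apply: (LEF_full_group (@subshift_compact _ _ x)) => //.
    exact: subshift_zero_dimensional.
  exact: free_topologically_free.
exists bool, x; split=> //; apply: LEF_sofic => //.
exact: subshift_full_group_countable.
Qed.
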